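(* Let $n\ge 1$, $0<p<1$, and let $V:\mathbb{R}^n\times[0,\infty)\to[0,\infty)$ be continuous. Suppose there are a continuous function $\Lambda:[0,\infty)\to[0,\infty)$ and constants $\vartheta>0$, $\sigma\in\mathbb{R}$ such that $$V(x,t)\le \vartheta\,\Lambda(t)\,(1+|x|^2)^{\sigma_+/2}\qquad\text{for all }x\in\mathbb{R}^n,\ t\ge 0 .$$ Let $a\ge \frac{\sigma_+}{1-p}$. Then for every $u_0\in BC_a$ with $u_0\ge 0$, the Cauchy problem $\partial_t u-\Delta\partial_t u=\Delta u+V(x,t)u^p$ in $\mathbb{R}^n\times(0,\infty)$, $u(\cdot,0)=u_0$, has a global mild solution $0\le u\in \mathcal{Z}_{\infty,a}$.
   Context: $\sigma_+=\max\{\sigma,0\}$. $\mathcal{B}=(I-\Delta)^{-1}$ is the Bessel potential operator on $\mathbb{R}^n$, $\mathcal{B}\varphi=B*\varphi$ with $B=\mathcal{F}^{-1}\big((1+|\xi|^2)^{-1}\big)$ (a positive kernel with $\int B=1$). The pseudoparabolic Green operator is $\mathcal{G}(t)\varphi=e^{-t}\sum_{k\ge0}\frac{t^k}{k!}\mathcal{B}^k\varphi$. For $a\in\mathbb{R}$, $BC_a$ is the space of continuous $\varphi$ on $\mathbb{R}^n$ with $|\varphi(x)|\le C|x|^a$ for $|x|$ large, normed by $\|\varphi\|_{R,a}=\sup_x (R^2+|x|^2)^{-a/2}|\varphi(x)|$ ($R>0$; all these norms are equivalent). For $0<T\le\infty$, $\mathcal{Z}_{T,a}=C([0,T);BC_a)$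 and $Q_T=\mathbb{R}^n\times[0,T)$. A (mild) solution on $Q_T$ is $0\le u\in\mathcal{Z}_{T,a}$ with $u(t)=\mathcal{G}(t)u_0+\int_0^t\mathcal{G}(t-\tau)\mathcal{B}[V u^p](\tau)\,d\tau$ on $Q_T$; it is global if $T=\infty$. *)

(* Defs.v *)
From HB Require Import structures.
From mathcomp Require Import all_boot all_order all_algebra.
From mathcomp Require Import all_classical all_reals all_analysis.
Set Implicit Arguments. Unset Strict Implicit. Unset Printing Implicit Defensive.
Import Order.TTheory GRing.Theory Num.Theory numFieldNormedType.Exports.
Local Open Scope classical_set_scope.
Local Open Scope ring_scope.

Section Defs.
Variable R : realType.

Definition enorm n (x : 'rV[R]_n) : R := Num.sqrt (\sum_(i < n) x ord0 i ^+ 2).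

Definition ppart (s : R) : R := Num.max s 0.

Definition cons_rV n (s : R) (y : 'rV[R]_n) : 'rV[R]_n.+1 :=
  \row_(i < n.+1) match unlift ord0 i with Some j => y ord0 j | None => s end.

(* Lebesgue integral over R^n, as the iterated one-dimensional Lebesgue
   integral (Tonelli); only ever applied to nonnegative integrands here. *)
Fixpoint intRn (n : nat) : ('rV[R]_n -> \bar R) -> \bar R :=
  match n with
  | 0 => fun f => f 0
  | m.+1 => fun f =>
      (\int[@lebesgue_measure R]_(s in [set: R]) intRn (fun y => f (cons_rV s y)))%E
  end.

(* Bessel kernel B = F^{-1}((1+|xi|^2)^{-1}), given by its standard
   (heat-kernel subordination) integral representation
   B(x) = int_0^oo (4 pi s)^{-n/2} e^{-s} e^{-|x|^2/(4 s)} ds. *)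
Definition bessel_kernel n (x : 'rV[R]_n) : \bar R :=
  (\int[@lebesgue_measure R]_(s in `]0%R, +oo[%classic)
     (powR (4 * pi * s) (- (n%:R / 2)) * expR (- s)
        * expR (- (enorm x ^+ 2 / (4 * s))))%:E)%E.

Definition bessel_op n (phi : 'rV[R]_n -> \bar R) (x : 'rV[R]_n) : \bar R :=
  intRn (fun y => bessel_kernel (x - y) * phi y)%E.

Definition green_op n (t : R) (phi : 'rV[R]_n -> \bar R) (x : 'rV[R]_n) : \bar R :=
  (\sum_(0 <= k <oo) (expR (- t) * t ^+ k / (k`!)%:R)%:E
                      * iter k (@bessel_op n) phi x)%E.

Definition BC n (a : R) (phi : 'rV[R]_n -> R) : Prop :=
  continuous phi /\
  exists C M : R, forall x, M <= enorm x -> `|phi x| <= C * powR (enorm x) a.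

(* weight (R0^2 + |x|^2)^{-a/2} of the norm ||.||_{R0,a}; we take R0 = 1
   (all these norms are equivalent). *)
Definition weight n (a : R) (x : 'rV[R]_n) : R := powR (1 + enorm x ^+ 2) (- (a / 2)).

(* u in Z_{oo,a} = C([0,oo); BC_a): u(t) in BC_a for every t >= 0 and
   t |-> u(t) is continuous on [0,oo) for the norm ||.||_{1,a}. *)
Definition Zspace n (a : R) (u : 'rV[R]_n -> R -> R) : Prop :=
  (forall t, 0 <= t -> BC a (fun x => u x t)) /\
  (forall t0, 0 <= t0 -> forall e, 0 < e -> exists2 d, 0 < d &
     forall t, 0 <= t -> `|t - t0| < d ->
       forall x, weight a x * `|u x t - u x t0| <= e).

Definition mild_eq n (p : R) (V : 'rV[R]_n -> R -> R) (u0 : 'rV[R]_n -> R)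
    (u : 'rV[R]_n -> R -> R) : Prop :=
  forall x t, 0 <= t ->
    (u x t)%:E =
      (green_op t (fun y => (u0 y)%:E) x +
       \int[@lebesgue_measure R]_(tau in `[0%R, t]%classic)
          green_op (t - tau)
            (bessel_op (fun y => (V y tau * powR (u y tau) p)%:E)) x)%E.

Definition global_mild_solution n (a p : R) (V : 'rV[R]_n -> R -> R)
    (u0 : 'rV[R]_n -> R) (u : 'rV[R]_n -> R -> R) : Prop :=
  (forall x t, 0 <= t -> 0 <= u x t) /\ Zspace a u /\ mild_eq p V u0 u.

End Defs.

(* Main.v *)
(** The Picard iterates started at 0 increase and, since p < 1, stay below M w on every
    [0, T], where w(x) = (1 + |x|^2)^(a/2): the potential B satisfies B w <= K w, so a constant
    M with e^(K T) (A + T K (theta L M^p + 1)) <= M does it. By monotone convergence their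
    limit solves the mild equation, so no compactness is needed.

    All functions involved are nonnegative and lower semicontinuous. This class is stable under
    sums, products, increasing limits and (by Fatou) integration in some of the variables,
    which supplies the measurability needed for the iterated integrals. Continuity in x is then
    reduced to upper semicontinuity, which B provides uniformly on {0 <= f <= M w}; continuity
    in t comes from e^t u(t) being nondecreasing in t and from the elementary bound
    t'^(k+1) <= t^(k+1) + (k+1) (t' - t) t'^k on the coefficients of the Green operator. *)
Require Import Defs.
From HB Require Import structures.
From mathcomp Require Import all_boot all_order all_algebra.
From mathcomp Require Import all_classical all_reals all_analysis.
From mathcomp Require Import measurable_realfun ring lra.
Set Implicit Arguments. Unset Strict Implicit. Unset Printing Implicit Defensive.
Import Order.TTheory GRing.Theory Num.Theory numFieldNormedType.Exports.
Local Open Scope classical_set_scope.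
Local Open Scope ring_scope.

(** * Nonnegative lower semicontinuous functions *)

Section nonneg_lsc.
Context {R : realType}.
Local Open Scope ereal_scope.

(** The kernel is infinite at the origin when n >= 2, and the integral over R^n is an iterated one,
    so each partial integral has to be measurable in the remaining variables. This is why the
    functions are extended-valued and belong to a class closed under partial integration with
    parameters. For p < 1 the map r -> r^p is not Lipschitz at 0, which rules out a direct
    contraction argument; the iteration uses only that r^p is increasing and continuous. The bound M
    depends on T but the iterates do not, so one increasing sequence serves all times and its limit
    is global at once, with no continuation of local solutions. The condition on a says exactly that
    sigma_+ + a p <= a, so the source V u^p is again dominated by a multiple of w and all iterates
    stay in one weighted class. Negative times are kept, with time clamped to 0, so that lower
    semicontinuity can be stated on the whole of R x R^n without a boundary. *)

Definition nnlsc {X : topologicalType} (f : X -> \bar R) :=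
  (forall x, 0 <= f x) /\ lower_semicontinuous f.

Definition ndcvg (u : nat -> \bar R) (l : \bar R) :=
  nondecreasing_seq u /\ u @ \oo --> l.

Lemma ndcvgP u l : ndcvg u l <-> nondecreasing_seq u /\ l = ereal_sup (range u).
Proof.
split=> -[ndu ul]; split=> //.
  exact: (cvg_unique _ ul (ereal_nondecreasing_cvgn ndu)).
by rewrite ul; exact: ereal_nondecreasing_cvgn.
Qed.

Lemma ndcvg_le u l k : ndcvg u l -> u k <= l.
Proof. by move=> /ndcvgP[_ ->]; apply: ereal_sup_ubound; exists k. Qed.

Lemma ndcvg_lt u l a : ndcvg u l -> a < l -> exists k, a < u k.
Proof.
by move=> /ndcvgP[_ ->] /ereal_sup_gt[_ [k _ <-] ak]; exists k.
Qed.

Lemma lee_EFin_lt (u v : \bar R) : (forall b : R, b%:E < u -> b%:E <= v) -> u <= v.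
Proof.
move: u v => [u| |] [v| |] uv; rewrite ?leey ?leNye //.
- rewrite lee_fin leNgt; apply/negP => vu.
  suff : ((u + v) / 2 <= v)%R by lra.
  by rewrite -lee_fin uv// lte_fin; lra.
- by have := uv (u - 1)%R; rewrite lte_fin ltrBlDr ltrDl => /(_ ltr01).
- by have := uv (v + 1)%R (ltry _); rewrite lee_fin gerDl ler10.
- by have := uv 0%R (ltry _).
Qed.

Section topological.
Context {X : topologicalType}.
Implicit Types f g : X -> \bar R.

(** Negative thresholds are automatic for a nonnegative function. Restricting to a >= 0 is what
    makes the product rule below work. *)
Lemma nnlscW f : (forall x, 0 <= f x) ->
  (forall x a, (0 <= a)%R -> a%:E < f x -> \forall y \near x, a%:E < f y) ->
  nnlsc f.
Proof.
move=> f0 lf; split => // x a afx.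
have [a0|a0] := leP 0%R a.
  by exists [set y | a%:E < f y] => //; exact: lf.
exists setT; first exact: filterT.
by move=> y _; apply: lt_le_trans (f0 y); rewrite lte_fin.
Qed.

Lemma nnlsc_near f x a : nnlsc f -> a%:E < f x -> \forall y \near x, a%:E < f y.
Proof. by move=> [_ lf] /lf[V nV Va]; exact: filterS Va nV. Qed.

Lemma nnlsc_ge0 f x : nnlsc f -> 0 <= f x.
Proof. by case. Qed.

End topological.

Section nnlsc_calculus.
Context {X Y : topologicalType}.
Implicit Types f g : X -> \bar R.

Lemma continuous_pair (Z : topologicalType) (f : X -> Y) (g : X -> Z) :
  continuous f -> continuous g -> continuous (fun x => (f x, g x)).
Proof. by move=> cf cg x; exact: (cvg_pair (cf x) (cg x)). Qed.

Lemma nnlsc_EFin (f : X -> R) : continuous f -> (forall x, 0 <= f x)%R ->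
  nnlsc (fun x => (f x)%:E).
Proof.
move=> cf f0; apply: nnlscW => [x|x a _]; first by rewrite lee_fin.
rewrite lte_fin => afx; apply: (cf x [set y | a%:E < y%:E]).
by apply: filterS (lt_nbhsr afx) => y; rewrite /= lte_fin.
Qed.

Lemma nnlsc_cst c : 0 <= c -> nnlsc (fun _ : X => c).
Proof. by move=> c0; apply: nnlscW => // x a _ ac; exact: nearW. Qed.

Lemma nnlsc_comp (phi : Y -> X) f :
  continuous phi -> nnlsc f -> nnlsc (f \o phi).
Proof.
move=> cphi nf; apply: nnlscW => [x|x a _ afx]; first exact: (nnlsc_ge0 (phi x) nf).
exact: (cphi x _ (nnlsc_near nf afx)).
Qed.

Lemma lt_adde_split (a : R) (u v : \bar R) : 0 <= u -> 0 <= v -> a%:E < u + v ->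
  exists b c : R, [/\ b%:E < u, c%:E < v & (a <= b + c)%R].
Proof.
move: u v => [u| |] [v| |] //=; rewrite ?lee_fin => u0 v0.
- rewrite -EFinD lte_fin => auv.
  exists (u - (u + v - a) / 2)%R, (v - (u + v - a) / 2)%R.
  by rewrite !lte_fin; split; lra.
- by move=> _; exists (u - 1)%R, (a - u + 1)%R; rewrite lte_fin ltry; split=> //; lra.
- by move=> _; exists (a - v + 1)%R, (v - 1)%R; rewrite lte_fin ltry; split=> //; lra.
- by move=> _; exists a, 0%R; rewrite !ltry addr0; split.
Qed.

Lemma nnlscD f g : nnlsc f -> nnlsc g -> nnlsc (fun x => f x + g x).
Proof.
move=> nf ng; apply: nnlscW => [x|x a _].
  by rewrite adde_ge0 ?(nnlsc_ge0 _ nf) ?(nnlsc_ge0 _ ng).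
move=> /(lt_adde_split (nnlsc_ge0 _ nf) (nnlsc_ge0 _ ng))[b [c [bf cg abc]]].
have := nnlsc_near nf bf; have := nnlsc_near ng cg; apply: filterS2 => y cgy bfy.
by apply: (@le_lt_trans _ _ (b%:E + c%:E)); [rewrite lee_fin|exact: lteD].
Qed.

(** For finite factors b is the midpoint of a / v and u, and c = a / b. If one factor is infinite,
    the other is either 0, which the convention 0 * oo = 0 excludes, or leaves room for a large
    c. *)
Lemma lt_mule_split (a : R) (u v : \bar R) : (0 <= a)%R -> 0 <= u -> 0 <= v ->
  a%:E < u * v ->
  exists b c : R, [/\ b%:E < u, c%:E < v, (0 <= b)%R, (0 <= c)%R & (a <= b * c)%R].
Proof.
move=> a0; move: u v => [u| |] [v| |] //=; rewrite ?lee_fin => u0 v0.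
- rewrite -EFinM lte_fin => auv.
  have {}u0 : (0 < u)%R.
    by rewrite lt_neqAle u0 andbT eq_sym; apply: contraTneq auv => ->; rewrite mul0r -leNgt.
  have {}v0 : (0 < v)%R.
    by rewrite lt_neqAle v0 andbT eq_sym; apply: contraTneq auv => ->; rewrite mulr0 -leNgt.
  have avu : (a / v < u)%R by rewrite ltr_pdivrMr.
  have b0 : (0 < (a / v + u) / 2)%R by rewrite divr_gt0// ltr_wpDl// divr_ge0// ltW.
  set b := ((a / v + u) / 2)%R in b0 *.
  have avb : (a < b * v)%R.
    by rewrite -ltr_pdivrMr// /b; move: avu; set q := (a / v)%R; lra.
  exists b, (a / b)%R; rewrite !lte_fin; split=> //.
  - by rewrite /b; move: avu; set q := (a / v)%R; lra.
  - by rewrite ltr_pdivrMr// mulrC.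
  - exact: ltW.
  - by rewrite divr_ge0// ltW.
  - by rewrite mulrC divfK// gt_eqF.
- rewrite le_eqVlt in u0; case/predU1P : u0 => [<-|u0 _].
    by rewrite mul0e lte_fin ltNge a0.
  exists (u / 2)%R, (a / (u / 2))%R; rewrite lte_fin ltry.
  have u20 : (0 < u / 2)%R by rewrite divr_gt0.
  by split=> //; [lra|lra|rewrite divr_ge0//; lra|rewrite mulrC divfK ?gt_eqF].
- rewrite le_eqVlt in v0; case/predU1P : v0 => [<-|v0 _].
    by rewrite mule0 lte_fin ltNge a0.
  exists (a / (v / 2))%R, (v / 2)%R; rewrite lte_fin ltry.
  have v20 : (0 < v / 2)%R by rewrite divr_gt0.
  by split=> //; [lra|rewrite divr_ge0//; lra|lra|rewrite divfK ?gt_eqF].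
- by move=> _; exists a, 1%R; rewrite !ltry mulr1; split.
Qed.

Lemma nnlscM f g : nnlsc f -> nnlsc g -> nnlsc (fun x => f x * g x).
Proof.
move=> nf ng; apply: nnlscW => [x|x a a0].
  by rewrite mule_ge0 ?(nnlsc_ge0 _ nf) ?(nnlsc_ge0 _ ng).
move=> /(lt_mule_split a0 (nnlsc_ge0 _ nf) (nnlsc_ge0 _ ng))[b [c [bf cg b0 c0 abc]]].
have := nnlsc_near nf bf; have := nnlsc_near ng cg; apply: filterS2 => y cgy bfy.
by apply: (@le_lt_trans _ _ (b%:E * c%:E)); [rewrite lee_fin|exact: lte_pmul].
Qed.

Lemma nnlscZ (c : R) f : (0 <= c)%R -> nnlsc f -> nnlsc (fun x => c%:E * f x).
Proof. by move=> c0; apply: nnlscM; exact: nnlsc_cst. Qed.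

Lemma nnlsc_min f g : nnlsc f -> nnlsc g -> nnlsc (fun x => mine (f x) (g x)).
Proof.
move=> nf ng; apply: nnlscW => [x|x a _].
  by rewrite le_min ?(nnlsc_ge0 _ nf) ?(nnlsc_ge0 _ ng).
rewrite lt_min => /andP[af ag].
have := nnlsc_near nf af; have := nnlsc_near ng ag; apply: filterS2 => y agy afy.
by rewrite lt_min afy.
Qed.

Lemma nnlsc_ndcvg (f : nat -> X -> \bar R) g : (forall k, nnlsc (f k)) ->
  (forall x, ndcvg (f ^~ x) (g x)) -> nnlsc g.
Proof.
move=> nf fg; apply: nnlscW => [x|x a _].
  by apply: le_trans (ndcvg_le 0 (fg x)); exact: nnlsc_ge0.
move=> /(ndcvg_lt (fg x))[k ak]; have := nnlsc_near (nf k) ak.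
by apply: filterS => y /lt_le_trans; apply; exact: ndcvg_le (fg y).
Qed.

Lemma ndcvg_series (u : nat -> \bar R) : (forall k, 0 <= u k) ->
  ndcvg (fun K => \sum_(0 <= k < K) u k) (\sum_(0 <= k <oo) u k).
Proof.
move=> u0; split; first exact: ereal_nondecreasing_series.
exact: is_cvg_nneseries.
Qed.

Lemma nnlsc_series (f : nat -> X -> \bar R) : (forall k, nnlsc (f k)) ->
  nnlsc (fun x => \sum_(0 <= k <oo) f k x).
Proof.
move=> nf; apply: (@nnlsc_ndcvg (fun K x => \sum_(0 <= k < K) f k x)).
  elim=> [|K IH].
    rewrite (_ : (fun _ => _) = fun=> 0); last by apply/funext => x; rewrite big_geq.
    exact: nnlsc_cst.
  rewrite (_ : (fun _ => _) = fun x => \sum_(0 <= k < K) f k x + f K x).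
    exact: nnlscD.
  by apply/funext => x; rewrite big_nat_recr.
by move=> x; apply: ndcvg_series => k; exact: nnlsc_ge0.
Qed.

(** Extension by 0 from an open set only creates downward jumps when leaving that set, which lower
    semicontinuity allows. Kernels restricted to s > 0 and integrals over moving open intervals are
    treated this way. *)
Lemma nnlsc_if (A : pred X) f : open [set x | A x] -> (forall x, A x -> 0 <= f x) ->
  (forall x a, A x -> a%:E < f x -> \forall y \near x, a%:E < f y) ->
  nnlsc (fun x => if A x then f x else 0).
Proof.
move=> oA f0 lf; apply: nnlscW => [x|x a a0]; first by case: ifPn => // /f0.
case: ifPn => [Ax afx|]; last by rewrite lte_fin ltNge a0.
have := open_nbhs_nbhs (conj oA (Ax : [set x | A x] x)); have := lf _ _ Ax afx.
by apply: filterS2 => y afy /= ->.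
Qed.

Lemma nnlsc_if_EFin (A : pred X) (f : X -> R) : open [set x | A x] ->
  (forall x, A x -> 0 <= f x)%R -> (forall x, A x -> {for x, continuous f}) ->
  nnlsc (fun x => if A x then (f x)%:E else 0).
Proof.
move=> oA f0 cf; apply: nnlsc_if => // x a Ax; rewrite lte_fin => afx.
apply: (cf x Ax [set y | a%:E < y%:E]).
by apply: filterS (lt_nbhsr afx) => y; rewrite /= lte_fin.
Qed.

End nnlsc_calculus.

Lemma nnlsc_measurable (f : R -> \bar R) (D : set R) : nnlsc f -> measurable_fun D f.
Proof.
by move=> [_ lf]; apply: measurable_funTS; exact: lower_semicontinuous_measurable.
Qed.

Local Notation mu := (@lebesgue_measure R).

(** Fatou's lemma along a sequence: if the integrals stayed at most a at points [xk k] tending to x,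
    so would the integral at x. *)
Lemma nnlsc_integral (X : pseudoMetricType R) (f : X * R -> \bar R) :
  nnlsc f -> nnlsc (fun x => \int[mu]_s f (x, s)).
Proof.
move=> nf; apply: nnlscW => [x|x a a0 afx].
  by apply: integral_ge0 => s _; exact: nnlsc_ge0.
apply: contrapT => nnear.
have nsec x' : nnlsc (fun s => f (x', s)).
  apply: (nnlsc_comp (phi := fun s : R => (x', s)) _ nf).
  by move=> s; apply: (cvg_pair (cvg_cst _) cvg_id).
have /choice[xk xkP] : forall k : nat, exists y, ball x (k.+1%:R^-1)%R y /\
    \int[mu]_s f (y, s) <= a%:E.
  move=> k; apply: contrapT => nex; apply: nnear.
  apply/nbhs_ballP; exists (k.+1%:R^-1)%R => /=; first by rewrite invr_gt0.
  move=> y xy; rewrite ltNge; apply/negP => fya; apply: nex.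
  by exists y.
have cx : xk @ \oo --> x.
  apply/cvg_ballP => e e0; near=> k.
  apply: (@le_ball _ _ x (k.+1%:R^-1)%R); last by case: (xkP k).
  by near: k; near do apply: ltW; exact: (near_infty_natSinv_lt (PosNum e0)).
suff : \int[mu]_s f (x, s) <= a%:E by rewrite leNgt afx.
(* Lower semicontinuity bounds f (x, s) by the lower limit of f (xk k, s). Capping the tail infimum
   by f (x, s) makes the increasing limit equal to f (x, s), so that monotone convergence
   applies. *)
pose g m s := mine (f (x, s)) (einfs (fun k => f (xk k, s)) m).
have g0 m s : 0 <= g m s.
  rewrite /g le_min nnlsc_ge0//=; apply: le_ereal_inf_tmp => _ [k _ <-].
  exact: nnlsc_ge0.
have mg m : measurable_fun setT (g m).
  apply: measurable_mine; first exact: nnlsc_measurable.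
  by apply: measurable_fun_einfs => k; exact: nnlsc_measurable.
have gf s : ndcvg (g ^~ s) (f (x, s)).
  apply/ndcvgP; split.
    move=> m1 m2 m12; rewrite /g le_min ge_min lexx/= ge_min.
    by apply/orP; right; exact: nondecreasing_einfs.
  apply/eqP; rewrite eq_le; apply/andP; split; last first.
    by apply: ge_ereal_sup => _ [m _ <-]; rewrite /g ge_min lexx.
  apply: lee_EFin_lt => b bfx.
  have [N _ NP] : \forall k \near \oo, b%:E < f (xk k, s).
    have cp : (xk k, s) @[k --> \oo] --> (x, s).
      exact: (cvg_pair cx (cvg_cst s)).
    exact: (cp _ (nnlsc_near nf bfx)).
  apply: (@le_trans _ _ (g N s)); last by apply: ereal_sup_ubound; exists N.
  rewrite /g le_min ltW//=; apply: le_ereal_inf_tmp => _ [k /= Nk <-].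
  by apply: ltW; exact: NP.
have cg : \int[mu]_s g m s @[m --> \oo] --> \int[mu]_s f (x, s).
  rewrite (_ : \int[mu]_s f (x, s) = \int[mu]_s limn (g ^~ s)).
    apply: cvg_monotone_convergence => // s _; exact: (gf s).1.
  by apply: eq_integral => s _; apply/esym/cvg_lim => //; case: (gf s).
rewrite -(cvg_lim _ cg)//; apply: lime_le; first by apply/cvg_ex; eexists; exact: cg.
apply: nearW => m; apply: le_trans (xkP m).2.
apply: ge0_le_integral => //.
- exact: mg.
- exact: nnlsc_measurable.
- move=> s _; rewrite /g ge_min; apply/orP; right.
  by apply: ereal_inf_lbound; exists m => /=.
Unshelve. all: by end_near. Qed.

End nonneg_lsc.

(** * The iterated integral over R^n *)

Section intRn_theory.
Context {R : realType}.
Local Open Scope ereal_scope.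
Local Notation mu := (@lebesgue_measure R).

Lemma continuous_compT (X Y Z : topologicalType) (f : X -> Y) (g : Y -> Z) :
  continuous f -> continuous g -> continuous (fun x => g (f x)).
Proof. by move=> cf cg x; exact: (@continuous_comp _ _ _ f g x (cf x) (cg (f x))). Qed.

Lemma continuous_fst (X Y : topologicalType) : continuous (@fst X Y).
Proof. by move=> x; exact: cvg_fst. Qed.

Lemma continuous_snd (X Y : topologicalType) : continuous (@snd X Y).
Proof. by move=> x; exact: cvg_snd. Qed.

Lemma continuous_sum (X : topologicalType) I (r : seq I) (F : I -> X -> R) :
  (forall i, continuous (F i)) -> continuous (fun x => \sum_(i <- r) F i x)%R.
Proof.
move=> cF; elim: r => [|i r IH].
  rewrite (_ : (fun _ => _) = fun=> 0%R); first by move=> x; exact: cvg_cst.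
  by apply/funext => x; rewrite big_nil.
rewrite (_ : (fun _ => _) = fun x => F i x + \sum_(j <- r) F j x)%R.
  by move=> x; apply: (@cvgD _ R^o); [exact: cF|exact: IH].
by apply/funext => x; rewrite big_cons.
Qed.

Lemma continuous_for_prod (X : topologicalType) I (r : seq I) (F : I -> X -> R) x :
  (forall i, {for x, continuous (F i)}) ->
  {for x, continuous (fun x => \prod_(i <- r) F i x)%R}.
Proof.
move=> cF; elim: r => [|i r IH].
  rewrite (_ : (fun _ => _) = fun=> 1%R); first exact: cvg_cst.
  by apply/funext => y; rewrite big_nil.
rewrite (_ : (fun _ => _) = fun x => F i x * \prod_(j <- r) F j x)%R.
  by apply: cvgM; [exact: cF|exact: IH].
by apply/funext => y; rewrite big_cons.
Qed.

Lemma continuous_mx (X : topologicalType) m n (f : X -> 'M[R]_(m, n)) :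
  (forall i j, continuous (fun x => f x i j)) -> continuous f.
Proof.
move=> cf x; apply/cvg_ballP => e e0.
have : \forall y \near x, forall i j, ball (f x i j) e (f y i j).
  apply: filter_forall => i; apply: filter_forall => j.
  by have /cvg_ballP := cf i j x; apply.
by apply: filterS => y fy; split.
Qed.

Lemma cons_rV0 n (s : R) (y : 'rV[R]_n) : cons_rV s y ord0 ord0 = s.
Proof. by rewrite mxE unlift_none. Qed.

Lemma cons_rVS n (s : R) (y : 'rV[R]_n) j : cons_rV s y ord0 (lift ord0 j) = y ord0 j.
Proof. by rewrite mxE liftK. Qed.

Lemma continuous_cons_rV (X : topologicalType) n (f : X -> R) (g : X -> 'rV[R]_n) :
  continuous f -> continuous g -> continuous (fun x => cons_rV (f x) (g x)).
Proof.
move=> cf cg; apply: continuous_mx => i j.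
rewrite (_ : (fun x => _) = fun x => cons_rV (f x) (g x) ord0 j); last first.
  by apply/funext => x; rewrite (ord1 i).
case: (unliftP ord0 j) => [k|] ->.
  rewrite (_ : (fun x => _) = fun x => g x ord0 k); last first.
    by apply/funext => x; rewrite cons_rVS.
  exact: (continuous_compT cg (@coord_continuous _ _ _ _ _)).
rewrite (_ : (fun x => _) = f)//.
by apply/funext => x; rewrite cons_rV0.
Qed.

Lemma nnlsc_consl (X : topologicalType) n (f : X * 'rV[R]_n.+1 -> \bar R) : nnlsc f ->
  nnlsc (fun z : X * R * 'rV[R]_n => f (z.1.1, cons_rV z.1.2 z.2)).
Proof.
apply: nnlsc_comp; apply: continuous_pair.
  exact: (continuous_compT (@continuous_fst _ _) (@continuous_fst _ _)).
apply: continuous_cons_rV; last exact: continuous_snd.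
exact: (continuous_compT (@continuous_fst _ _) (@continuous_snd _ _)).
Qed.

(** The parameter space X is arbitrary because the induction moves the first coordinate into it,
    replacing X by X * R. *)
Lemma nnlsc_intRn n (X : pseudoMetricType R) (f : X * 'rV[R]_n -> \bar R) :
  nnlsc f -> nnlsc (fun x => intRn (fun y => f (x, y))).
Proof.
elim: n X f => [|n IH] X f nf /=.
  apply: (nnlsc_comp (phi := fun x : X => (x, 0%R : 'rV[R]_0)) _ nf).
  apply: continuous_pair; first by move=> x; exact: cvg_id.
  by move=> x; exact: cvg_cst.
apply: (nnlsc_integral (f := fun xs => intRn (fun y => f (xs.1, cons_rV xs.2 y)))).
exact: (IH _ _ (nnlsc_consl nf)).
Qed.

Lemma nnlsc_cons n (f : 'rV[R]_n.+1 -> \bar R) : nnlsc f ->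
  nnlsc (fun z : R * 'rV[R]_n => f (cons_rV z.1 z.2)).
Proof.
apply: nnlsc_comp; apply: continuous_cons_rV;
  [exact: continuous_fst|exact: continuous_snd].
Qed.

Lemma nnlsc_sec (X Y : topologicalType) (f : X * Y -> \bar R) x :
  nnlsc f -> nnlsc (fun y => f (x, y)).
Proof.
apply: (nnlsc_comp (phi := fun y => (x, y))).
by apply: continuous_pair => z; [exact: cvg_cst|exact: cvg_id].
Qed.

Lemma nnlsc_intRn_cons n (f : 'rV[R]_n.+1 -> \bar R) : nnlsc f ->
  nnlsc (fun s => intRn (fun y => f (cons_rV s y))).
Proof.
move=> nf; exact: (nnlsc_intRn (f := fun z => f (cons_rV z.1 z.2)) (nnlsc_cons nf)).
Qed.

Lemma nnlsc_cons1 n (f : 'rV[R]_n.+1 -> \bar R) s : nnlsc f ->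
  nnlsc (fun y => f (cons_rV s y)).
Proof. move=> nf; exact: (nnlsc_sec s (nnlsc_cons nf)). Qed.

Lemma intRn_ge0 n (f : 'rV[R]_n -> \bar R) : (forall y, 0 <= f y) -> 0 <= intRn f.
Proof.
elim: n f => [|n IH] f f0 //=.
by apply: integral_ge0 => s _; exact: IH.
Qed.

Lemma intRn0 n : intRn (fun _ : 'rV[R]_n => 0) = 0.
Proof. by elim: n => [|n IH] //=; rewrite integral0_eq. Qed.

Lemma eq_intRn n (f g : 'rV[R]_n -> \bar R) : f =1 g -> intRn f = intRn g.
Proof. by move=> /funext ->. Qed.

Lemma le_intRn n (f g : 'rV[R]_n -> \bar R) : nnlsc f -> nnlsc g ->
  (forall y, f y <= g y) -> intRn f <= intRn g.
Proof.
elim: n f g => [|n IH] f g nf ng fg //=.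
apply: ge0_le_integral => //.
- by move=> s _; exact: (nnlsc_ge0 _ (nnlsc_intRn_cons nf)).
- exact: (nnlsc_measurable (nnlsc_intRn_cons nf)).
- exact: (nnlsc_measurable (nnlsc_intRn_cons ng)).
- by move=> s _; apply: IH => //; exact: nnlsc_cons1.
Qed.

Lemma intRnD n (f g : 'rV[R]_n -> \bar R) : nnlsc f -> nnlsc g ->
  intRn (fun y => f y + g y) = intRn f + intRn g.
Proof.
elim: n f g => [|n IH] f g nf ng //=.
rewrite -ge0_integralD//.
- by apply: eq_integral => s _; apply: IH; exact: nnlsc_cons1.
- by move=> s _; exact: (nnlsc_ge0 _ (nnlsc_intRn_cons nf)).
- exact: (nnlsc_measurable (nnlsc_intRn_cons nf)).
- by move=> s _; exact: (nnlsc_ge0 _ (nnlsc_intRn_cons ng)).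
- exact: (nnlsc_measurable (nnlsc_intRn_cons ng)).
Qed.

Lemma intRnZ n (c : R) (f : 'rV[R]_n -> \bar R) : (0 <= c)%R -> nnlsc f ->
  intRn (fun y => c%:E * f y) = c%:E * intRn f.
Proof.
move=> c0; elim: n f => [|n IH] f nf //=.
rewrite -ge0_integralZl//.
- by apply: eq_integral => s _; apply: IH; exact: nnlsc_cons1.
- exact: (nnlsc_measurable (nnlsc_intRn_cons nf)).
- by move=> s _; exact: (nnlsc_ge0 _ (nnlsc_intRn_cons nf)).
Qed.

Lemma ndcvg_integral (D : set R) (f : nat -> R -> \bar R) (g : R -> \bar R) :
  measurable D -> (forall k, nnlsc (f k)) ->
  (forall s, D s -> ndcvg (f ^~ s) (g s)) ->
  ndcvg (fun k => \int[mu]_(s in D) f k s) (\int[mu]_(s in D) g s).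
Proof.
move=> mD nf fg; split.
  move=> k l kl; apply: ge0_le_integral => //.
  - by move=> s _; exact: nnlsc_ge0.
  - exact: nnlsc_measurable.
  - exact: nnlsc_measurable.
  - by move=> s Ds; exact: (fg s Ds).1.
rewrite (_ : \int[mu]_(s in D) g s = \int[mu]_(s in D) limn (f ^~ s)).
  apply: cvg_monotone_convergence => //.
  - by move=> k; exact: nnlsc_measurable.
  - by move=> k s _; exact: nnlsc_ge0.
  - by move=> s Ds; exact: (fg s Ds).1.
apply: eq_integral => s; rewrite inE => Ds.
by apply/esym/cvg_lim => //; exact: (fg s Ds).2.
Qed.

Lemma ndcvg_intRn n (f : nat -> 'rV[R]_n -> \bar R) g : (forall k, nnlsc (f k)) ->
  (forall y, ndcvg (f ^~ y) (g y)) -> ndcvg (fun k => intRn (f k)) (intRn g).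
Proof.
elim: n f g => [|n IH] f g nf fg /=; first exact: fg.
apply: ndcvg_integral => //; first by move=> k; exact: nnlsc_intRn_cons.
by move=> s _; apply: IH => // k; exact: nnlsc_cons1.
Qed.

(** * Translation invariance of the iterated integral *)

Lemma measurable_shift (c : R) :
  measurable_fun [set: measurableTypeR R] (fun s : measurableTypeR R => s + c : measurableTypeR R)%R.
Proof. exact: measurable_funD. Qed.

(** The translated measure agrees with Lebesgue measure on the intervals ]a, b], which determine
    it. *)
Lemma lebesgue_measure_shift (c : R) (A : set (measurableTypeR R)) : measurable A ->
  pushforward mu (fun s : measurableTypeR R => s + c : measurableTypeR R)%R A = mu A.
Proof.
have mc := measurable_shift c.
move=> mA; apply/esym/lebesgue_measure_unique => //= _ [[a b]] _ <-.
rewrite /pushforward (_ : _ @^-1` _ = `]a - c, b - c]%classic)%R; last first.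
  by apply/seteqP; split => x /=; rewrite !in_itv/= ltrBlDr lerBrDr.
rewrite !lebesgue_measure_itv/= !lte_fin ltrD2r.
by case: ifPn => // _; rewrite -!EFinD; congr (_%:E); rewrite opprB addrA subrK.
Qed.

Lemma integral_shift (c : R) (f : R -> \bar R) : nnlsc f ->
  \int[mu]_s f (s + c)%R = \int[mu]_s f s.
Proof.
move=> nf; have mc := measurable_shift c.
transitivity (\int[pushforward mu (fun s : measurableTypeR R => s + c : measurableTypeR R)%R]_s f s).
  rewrite ge0_integral_pushforward//; first exact: (nnlsc_measurable nf).
  by move=> s _; exact: nnlsc_ge0.
by apply: eq_measure_integral => //= A mA _; exact: lebesgue_measure_shift.
Qed.

Lemma intRn_shift n (c : 'rV[R]_n) (f : 'rV[R]_n -> \bar R) : nnlsc f ->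
  intRn (fun y => f (y + c)%R) = intRn f.
Proof.
elim: n c f => [|n IH] c f nf /=; first by rewrite (thinmx0 (0 + c)%R).
pose c' : 'rV[R]_n := \row_j c ord0 (lift ord0 j).
have cE s (y : 'rV[R]_n) : (cons_rV s y + c = cons_rV (s + c ord0 ord0) (y + c'))%R.
  apply/rowP => i; rewrite mxE; case: (unliftP ord0 i) => [j|] ->.
    by rewrite !cons_rVS !mxE.
  by rewrite !cons_rV0.
rewrite -(integral_shift (c ord0 ord0) (nnlsc_intRn_cons nf)).
apply: eq_integral => s _.
rewrite -(IH c' _ (nnlsc_cons1 (s + c ord0 ord0)%R nf)).
by apply: eq_intRn => y; rewrite cE.
Qed.

(** An open set of the plane is the countable union of the rational boxes that it contains. This
    gives joint measurability of lower semicontinuous functions, hence Tonelli. *)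
Lemma open_measurable_prod (A : set (R * R)) : open A ->
  measurable (A : set (measurableTypeR R * measurableTypeR R)).
Proof.
move=> oA.
pose box (r : rat * rat * (rat * rat)) : set (R * R) :=
  `]ratr r.1.1, ratr r.1.2[%classic `*` `]ratr r.2.1, ratr r.2.2[%classic.
pose boxA r := if `[< box r `<=` A >] then box r else set0.
have -> : A = \bigcup_r boxA r.
  apply/seteqP; split; last by move=> z [r _]; rewrite /boxA; case: asboolP => // rA /rA.
  move=> [z1 z2] Az.
  have /nbhs_ballP[e /= e0 zA] := open_nbhs_nbhs (conj oA Az).
  have /rat_in_itvoo[p1] : (z1 - e < z1)%R by rewrite gtrBl.
  have /rat_in_itvoo[p2] : (z1 < z1 + e)%R by rewrite ltrDl.
  have /rat_in_itvoo[q1] : (z2 - e < z2)%R by rewrite gtrBl.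
  have /rat_in_itvoo[q2] : (z2 < z2 + e)%R by rewrite ltrDl.
  rewrite !in_itv/= => /andP[q21 q22] /andP[q11 q12] /andP[p21 p22] /andP[p11 p12].
  exists ((p1, p2), (q1, q2)) => //; rewrite /boxA.
  case: asboolP => [_|nA]; first by split; rewrite /= in_itv/= ?p12 ?q12.
  case: nA => -[x1 x2] [/=]; rewrite !in_itv/= => /andP[x11 x12] /andP[x21 x22].
  by apply: zA; split; rewrite /= /ball/= ltr_norml; lra.
apply: countable_bigcupT_measurable => // r; rewrite /boxA; case: asboolP => // _.
exact: measurableX.
Qed.

Lemma integral_swap (f : R * R -> \bar R) : nnlsc f ->
  \int[mu]_x \int[mu]_y f (x, y) = \int[mu]_y \int[mu]_x f (x, y).
Proof.
move=> nf; apply: (@fubini_tonelli _ _ (measurableTypeR R) (measurableTypeR R) R mu mu).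
  apply: (measurability _ (ErealGenOInfty.measurableE R)).
  move=> /= _ [_ [a ->]] <-; apply: measurableI => //; apply: open_measurable_prod.
  by rewrite preimage_itvoy; case: nf => _ /lower_semicontinuousP; exact.
by move=> x; exact: nnlsc_ge0.
Qed.

(** The variable s is moved past one coordinate at a time by the planar Tonelli theorem. *)
Lemma intRn_swap n (f : R * 'rV[R]_n -> \bar R) : nnlsc f ->
  intRn (fun y => \int[mu]_s f (s, y)) = \int[mu]_s intRn (fun y => f (s, y)).
Proof.
elim: n f => [|n IH] f nf //=.
have nf1 := nnlsc_consl nf.
rewrite (integral_swap (f := fun z => intRn (fun y => f (z.1, cons_rV z.2 y))))/=;
  last exact: (nnlsc_intRn nf1).
apply: eq_integral => t _; apply: (IH (fun z => f (z.1, cons_rV t z.2))).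
apply: (nnlsc_comp (phi := fun z => (z.1, cons_rV t z.2)) _ nf).
apply: continuous_pair; first exact: continuous_fst.
by apply: continuous_cons_rV; [move=> z; exact: cvg_cst|exact: continuous_snd].
Qed.

Lemma intRn_prod n (h : R -> R) (c : R) : continuous h -> (forall s, 0 <= h s)%R ->
  (0 <= c)%R -> \int[mu]_s (h s)%:E = c%:E ->
  intRn (fun y : 'rV[R]_n => (\prod_(i < n) h (y ord0 i))%:E) = (c ^+ n)%:E.
Proof.
move=> ch h0 c0 hc; elim: n => [|n IH] /=; first by rewrite big_ord0.
have np : nnlsc (fun y : 'rV[R]_n => (\prod_(i < n) h (y ord0 i))%:E).
  apply: nnlsc_EFin => [|y]; last by rewrite prodr_ge0.
  move=> y; apply: continuous_for_prod => i.
  exact: (continuous_compT (@coord_continuous _ _ _ _ _) ch).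
transitivity (\int[mu]_s ((h s)%:E * (c ^+ n)%:E)).
  apply: eq_integral => s _; rewrite -IH -intRnZ//; apply: eq_intRn => y.
  rewrite big_ord_recl cons_rV0 EFinM; congr (_ * _%:E).
  by apply: eq_bigr => i _; rewrite cons_rVS.
rewrite ge0_integralZr ?lee_fin ?exprn_ge0//.
- by rewrite hc -EFinM exprS.
- exact: (nnlsc_measurable (nnlsc_EFin ch h0)).
- by move=> s _; rewrite lee_fin.
Qed.

End intRn_theory.

(** * The Bessel kernel and its moments *)

Section bessel_kernel.
Context {R : realType}.
Local Notation mu := (@lebesgue_measure R).

Definition sqn n (x : 'rV[R]_n) : R := \sum_(i < n) x ord0 i ^+ 2.

Lemma sqn_ge0 n (x : 'rV[R]_n) : 0 <= sqn x.
Proof. by apply: sumr_ge0 => i _; exact: sqr_ge0. Qed.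

Lemma enorm_sqr n (x : 'rV[R]_n) : enorm x ^+ 2 = sqn x.
Proof. by rewrite /enorm sqr_sqrtr ?sqn_ge0. Qed.

Lemma sqnN n (x : 'rV[R]_n) : sqn (- x) = sqn x.
Proof. by apply: eq_bigr => i _; rewrite mxE sqrrN. Qed.

Lemma continuous_sqn n : continuous (@sqn n).
Proof.
apply: continuous_sum => i.
exact: (continuous_compT (g := fun r : R => r ^+ 2) (@coord_continuous _ _ _ _ _)
  (@exprn_continuous _ 2)).
Qed.

Definition heat n (z : 'rV[R]_n * R) : R :=
  (Num.sqrt (4 * pi * z.2))^-1 ^+ n * expR (- z.2) * expR (- (sqn z.1 / (4 * z.2))).

(** Extended by 0 to s <= 0, the subordination integrand is lower semicontinuous jointly in (x, s),
    and the kernel becomes an integral over the whole line. *)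
Definition heatE n (z : 'rV[R]_n * R) : \bar R := if 0 < z.2 then (heat z)%:E else 0%E.

Lemma powR_peak n (s : R) : 0 < s -> powR s (- (n%:R / 2)) = (Num.sqrt s)^-1 ^+ n.
Proof.
move=> s0; rewrite powRN [n%:R / 2]mulrC powRrM powR_mulrn ?powR_ge0//.
by rewrite powR12_sqrt ?ltW// exprVn.
Qed.

Lemma bessel_kernelE n (x : 'rV[R]_n) :
  bessel_kernel x = (\int[mu]_s heatE (x, s))%E.
Proof.
rewrite /bessel_kernel integral_mkcond; apply: eq_integral => s _.
rewrite patchE mem_setE in_itv/= andbT /heatE /heat/=.
by case: ifPn => // s0; rewrite enorm_sqr powR_peak// !mulr_gt0// pi_gt0.
Qed.

Lemma continuous_for_heat_exp (X : topologicalType) (f g : X -> R) (x : X) :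
  {for x, continuous f} -> {for x, continuous g} -> 0 < g x ->
  {for x, continuous (fun x => expR (- (f x / (4 * g x))))}.
Proof.
move=> cf cg g0; apply: (@continuous_comp _ _ _ (fun x => - (f x / (4 * g x))) expR);
  last exact: continuous_expR.
apply: (@cvgN _ R^o); apply: cvgM; first exact: cf.
apply: cvgV; first by rewrite gt_eqF// mulr_gt0.
by apply: cvgM; [exact: cvg_cst|exact: cg].
Qed.

Lemma continuous_for_peak (X : topologicalType) (g : X -> R) (x : X) :
  {for x, continuous g} -> 0 < g x ->
  {for x, continuous (fun x => (Num.sqrt (4 * pi * g x))^-1)}.
Proof.
move=> cg g0; apply: cvgV.
  by rewrite gt_eqF// sqrtr_gt0 !mulr_gt0// pi_gt0.
apply: (@continuous_comp _ _ _ (fun x => 4 * pi * g x) Num.sqrt).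
  by apply: cvgM; [exact: cvg_cst|exact: cg].
exact: sqrt_continuous.
Qed.

Lemma nnlsc_heatE n : nnlsc (@heatE n).
Proof.
apply: nnlsc_if_EFin.
- rewrite (_ : [set _ | _] = snd @^-1` [set s : R | 0 < s])//.
  by apply: open_comp; [move=> z _; exact: continuous_snd|exact: open_gt].
- by move=> z z0; rewrite !mulr_ge0 ?expR_ge0// exprn_ge0// invr_ge0 sqrtr_ge0.
- move=> z z0; apply: cvgM; [apply: cvgM|].
  + apply: (@continuous_comp _ _ _ (fun z : 'rV[R]_n * R => (Num.sqrt (4 * pi * z.2))^-1)
      (fun r => r ^+ n)); last exact: exprn_continuous.
    by apply: (@continuous_for_peak _ snd z) => //; exact: continuous_snd.
  + apply: (@continuous_comp _ _ _ (fun z : 'rV[R]_n * R => - z.2) expR);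
      last exact: continuous_expR.
    by apply: (@cvgN _ R^o); exact: continuous_snd.
  + apply: (@continuous_for_heat_exp _ (fun z : 'rV[R]_n * R => sqn z.1) snd z) => //;
      last exact: continuous_snd.
    exact: (continuous_compT (@continuous_fst _ _) (@continuous_sqn n)).
Qed.

Lemma nnlsc_bessel_kernel n : nnlsc (@bessel_kernel R n).
Proof.
rewrite (_ : @bessel_kernel R n = fun x => (\int[mu]_s heatE (x, s))%E).
  exact: (nnlsc_integral (@nnlsc_heatE n)).
by apply/funext => x; rewrite bessel_kernelE.
Qed.

Lemma bessel_kernelN n (x : 'rV[R]_n) : bessel_kernel (- x) = bessel_kernel x.
Proof. by rewrite !bessel_kernelE /heatE /heat/= sqnN. Qed.

(** Completing the square: a centred Gaussian of variance 2 s times exp(c t) or exp(- c t) is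
    exp(c^2 s) times the normal density of mean 2 c s or - 2 c s. *)
Lemma gauss_cosh (c s : R) : 0 < s ->
  (\int[mu]_t ((Num.sqrt (4 * pi * s))^-1 * expR (- (t ^+ 2 / (4 * s))) *
     (expR (c * t) + expR (- (c * t))))%:E = (2 * expR (c ^+ 2 * s))%:E)%E.
Proof.
move=> s0; pose sd := Num.sqrt (2 * s).
have sd0 : sd != 0 by rewrite gt_eqF// sqrtr_gt0 mulr_gt0.
have sd2 : sd ^+ 2 = 2 * s by rewrite sqr_sqrtr// mulr_ge0// ltW.
have pdf m t : normal_pdf m sd t = (Num.sqrt (4 * pi * s))^-1 *
    expR (- (t - m) ^+ 2 / (4 * s)).
  rewrite normal_pdfE// /normal_peak /normal_fun sd2.
  by congr (_^-1 * expR (_ / _)); [congr Num.sqrt; ring|ring].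
transitivity (\int[mu]_t ((expR (c ^+ 2 * s))%:E *
    ((normal_pdf (2 * c * s) sd t)%:E + (normal_pdf (- (2 * c * s)) sd t)%:E))%E)%E.
  apply: eq_integral => t _; rewrite -EFinD -EFinM; congr (_%:E).
  rewrite !pdf -mulrDr mulrCA -mulrA; congr (_ * _).
  rewrite !mulrDr -!expRD; congr (expR _ + expR _); field; exact: lt0r_neq0.
have mp m : measurable_fun [set: measurableTypeR R] (fun t => (normal_pdf m sd t)%:E).
  by apply/measurable_EFinP; exact: measurable_normal_pdf.
rewrite ge0_integralZl//.
- rewrite ge0_integralD//.
  + by rewrite !integral_normal_pdf -EFinD -EFinM mulrC.
  + by move=> t _; rewrite lee_fin normal_pdf_ge0.
  + by move=> t _; rewrite lee_fin normal_pdf_ge0.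
- exact: emeasurable_funD.
- by move=> t _; rewrite -EFinD lee_fin addr_ge0// normal_pdf_ge0.
Qed.

(** * The polynomial weight w, reciprocal to [weight], and its moment against the Bessel kernel *)

Definition wgt n (a : R) (x : 'rV[R]_n) : R := powR (1 + sqn x) (a / 2).

Lemma wgt_gt0 n a (x : 'rV[R]_n) : 0 < wgt a x.
Proof. by rewrite powR_gt0// ltr_pwDl ?sqn_ge0. Qed.

Lemma wgt_ge0 n a (x : 'rV[R]_n) : 0 <= wgt a x.
Proof. exact/ltW/wgt_gt0. Qed.

Lemma continuous_powR_gt0 (X : topologicalType) (f : X -> R) b : continuous f ->
  (forall x, 0 < f x) -> continuous (fun x => powR (f x) b).
Proof.
move=> cf f0; rewrite (_ : (fun _ => _) = fun x => expR (b * ln (f x))); last first.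
  by apply/funext => x; rewrite /powR gt_eqF.
have cl : continuous (fun x => ln (f x)).
  by move=> x; apply: (@continuous_comp _ _ _ f (@ln R) x (cf x)); exact: continuous_ln.
apply: (continuous_compT (f := fun x => b * ln (f x)) _ (@continuous_expR R)).
by move=> x; exact: (cvgM (cvg_cst b) (cl x)).
Qed.

Lemma continuous_wgt n a : continuous (@wgt n a).
Proof.
apply: continuous_powR_gt0 => x; last by rewrite ltr_pwDl ?sqn_ge0.
exact: (cvgD (cvg_cst _) (@continuous_sqn n x)).
Qed.

Lemma le_1Dsum_prod I (r : seq I) (f : I -> R) : (forall i, 0 <= f i) ->
  1 + \sum_(i <- r) f i <= \prod_(i <- r) (1 + f i).
Proof.
move=> f0; elim: r => [|i r IH]; first by rewrite !big_nil addr0.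
rewrite !big_cons; apply: (@le_trans _ _ ((1 + f i) * (1 + \sum_(j <- r) f j))).
  have : 0 <= f i * \sum_(j <- r) f j by rewrite mulr_ge0// sumr_ge0.
  by move: (\sum_(j <- r) f j) => S; lra.
by rewrite ler_wpM2l// addr_ge0.
Qed.

Lemma powR_prod I (r : seq I) (f : I -> R) b : (forall i, 0 <= f i) ->
  powR (\prod_(i <- r) f i) b = \prod_(i <- r) powR (f i) b.
Proof.
move=> f0; elim: r => [|i r IH]; first by rewrite !big_nil powR1.
by rewrite !big_cons powRM ?IH// prodr_ge0.
Qed.

(** A majorant that is a product over the coordinates lets the Gaussian moment factor into
    one-dimensional integrals. *)
Lemma wgt_prod n a (x : 'rV[R]_n) : 0 <= a ->
  wgt a x <= \prod_(i < n) powR (1 + x ord0 i ^+ 2) (a / 2).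
Proof.
move=> a0; rewrite -powR_prod => [|i]; last by rewrite addr_ge0// sqr_ge0.
apply: ge0_ler_powR; rewrite ?nnegrE ?divr_ge0//.
- by rewrite addr_ge0// sqn_ge0.
- by apply: prodr_ge0 => i _; rewrite addr_ge0// sqr_ge0.
- by apply: le_1Dsum_prod => i; exact: sqr_ge0.
Qed.

(** With k = c / (b + 1), the exponential series gives t^2 <= (2 / k^2) exp(k |t|); raising to the
    power b costs exp(k b |t|) <= exp(c |t|). The sum of both exponentials dominates exp(c |t|) and
    can be integrated exactly against a Gaussian. *)
Lemma powR_cosh (a c : R) : 0 <= a -> 0 < c -> exists2 D, 0 <= D &
  forall t : R, powR (1 + t ^+ 2) (a / 2) <= D * (expR (c * t) + expR (- (c * t))).
Proof.
move=> a0 c0; pose b := a / 2; pose k := c / (b + 1).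
have b0 : 0 <= b by rewrite divr_ge0.
have b10 : 0 < b + 1 by rewrite ltr_wpDl.
have k0 : 0 < k by rewrite divr_gt0.
exists (powR (1 + 2 / k ^+ 2) b); first exact: powR_ge0.
move=> t; rewrite -/b.
apply: (@le_trans _ _ (powR ((1 + 2 / k ^+ 2) * expR (k * `|t|)) b)).
  apply: ge0_ler_powR => //; rewrite ?nnegrE.
  - by rewrite addr_ge0// sqr_ge0.
  - by rewrite mulr_ge0 ?expR_ge0// addr_ge0// divr_ge0// sqr_ge0.
  have kt0 : 0 <= k * `|t| by rewrite mulr_ge0// ltW.
  rewrite mulrDl mul1r lerD//; first by rewrite -expR0 ler_expR.
  apply: (@le_trans _ _ (2 / k ^+ 2 * ((k * `|t|) ^+ 2 / 2))).
    have t2 : `|t| ^+ 2 = t ^+ 2 by rewrite -normrX ger0_norm ?sqr_ge0.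
    rewrite -t2 (_ : 2 / k ^+ 2 * _ = `|t| ^+ 2)//.
    by field; rewrite gt_eqF.
  rewrite ler_wpM2l ?divr_ge0 ?sqr_ge0//.
  by apply: le_trans (expR_ge1Dxn 1 kt0); rewrite /= lerDr.
rewrite powRM ?expR_ge0 ?addr_ge0 ?divr_ge0 ?sqr_ge0//.
rewrite ler_wpM2l ?powR_ge0// -expRM.
apply: (@le_trans _ _ (expR (c * `|t|))).
  rewrite ler_expR mulrAC ler_wpM2r// /k mulrAC -mulrA ler_piMr ?ltW//.
  by rewrite ltr_pdivrMr// mul1r ltrDl.
have [t0|t0] := leP 0 t; first by rewrite ger0_norm// lerDl expR_ge0.
by rewrite ltr0_norm// mulrN lerDr expR_ge0.
Qed.

(** The heat-kernel representation is integrated in y first. The weight is dominated by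
    exponentials, each coordinate then contributes 2 D exp(c^2 s), and for small c the factor exp(-
    s) still wins. *)
Lemma bessel_moment n a : 0 <= a -> exists C : R,
  (intRn (fun y : 'rV[R]_n => bessel_kernel y * (wgt a y)%:E) <= C%:E)%E.
Proof.
(* This c gives n c^2 <= 1/2, so exp(- s) exp(n c^2 s) <= exp(- s / 2). *)
move=> a0; pose c : R := n.+1%:R^-1.
have c0 : 0 < c by rewrite invr_gt0.
have [D D0 DP] := powR_cosh a0 c0.
pose h1 s t := (Num.sqrt (4 * pi * s))^-1 * expR (- (t ^+ 2 / (4 * s))) *
     (expR (c * t) + expR (- (c * t))).
pose h s t := h1 s t * D.
pose H (z : R * 'rV[R]_n) : \bar R :=
  if 0 < z.1 then (expR (- z.1) * \prod_(i < n) h z.1 (z.2 ord0 i))%:E else 0%E.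
have h10 s t : 0 <= h1 s t.
  by rewrite !mulr_ge0 ?expR_ge0 ?addr_ge0 ?invr_ge0 ?sqrtr_ge0 ?expR_ge0.
have h0 s t : 0 <= h s t by rewrite mulr_ge0.
have ch1 (X : topologicalType) (f : X -> R) (g : X -> R) (x : X) : {for x, continuous f} ->
    {for x, continuous g} -> 0 < f x -> {for x, continuous (fun x => h1 (f x) (g x))}.
  move=> cf cg f0; have ccg : {for x, continuous (fun x => c * g x)}.
    exact: (cvgM (cvg_cst c) cg).
  apply: cvgM; first apply: cvgM.
  - exact: (@continuous_for_peak _ f x).
  - apply: (@continuous_for_heat_exp _ (fun x => g x ^+ 2) f x) => //.
    by apply: (@continuous_comp _ _ _ g (fun r => r ^+ 2)) => //; exact: exprn_continuous.
  - apply: (@cvgD _ R^o).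
      exact: (@continuous_comp _ _ _ (fun x => c * g x) expR _ ccg (@continuous_expR R _)).
    apply: (@continuous_comp _ _ _ (fun x => - (c * g x)) expR _ _ (@continuous_expR R _)).
    exact: (@cvgN _ R^o _ _ _ _ _ ccg).
have ch (X : topologicalType) (f : X -> R) (g : X -> R) (x : X) : {for x, continuous f} ->
    {for x, continuous g} -> 0 < f x -> {for x, continuous (fun x => h (f x) (g x))}.
  by move=> cf cg f0; exact: (cvgM (ch1 _ _ _ _ cf cg f0) (cvg_cst D)).
have nH : nnlsc H.
  apply: nnlsc_if_EFin.
  - rewrite (_ : [set _ | _] = fst @^-1` [set s : R | 0 < s])//.
    by apply: open_comp; [move=> z _; exact: continuous_fst|exact: open_gt].
  - by move=> z z0; rewrite mulr_ge0 ?expR_ge0// prodr_ge0.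
  - move=> z z0; apply: cvgM.
      apply: (@continuous_comp _ _ _ (fun z : R * 'rV[R]_n => - z.1) expR);
        last exact: continuous_expR.
      by apply: (@cvgN _ R^o); exact: continuous_fst.
    apply: continuous_for_prod => i.
    apply: (ch _ fst (fun z : R * 'rV[R]_n => z.2 ord0 i)) => //; first exact: continuous_fst.
    exact: (continuous_compT (@continuous_snd _ _) (@coord_continuous _ _ _ _ _)).
exists ((2 * D) ^+ n * 2).
apply: (@le_trans _ _ (intRn (fun y => \int[mu]_s H (s, y))%E)).
  apply: le_intRn.
  - apply: nnlscM; first exact: nnlsc_bessel_kernel.
    by apply: nnlsc_EFin; [exact: continuous_wgt|move=> y; exact: wgt_ge0].
  - apply: (nnlsc_integral (f := fun z => H (z.2, z.1))).
    apply: (nnlsc_comp (phi := fun z : 'rV[R]_n * R => (z.2, z.1)) _ nH).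
    by apply: continuous_pair; [exact: continuous_snd|exact: continuous_fst].
  - move=> y; have nh := nnlsc_sec y (@nnlsc_heatE n).
    rewrite bessel_kernelE -ge0_integralZr//; first last.
    + by rewrite lee_fin wgt_ge0.
    + by move=> s _; exact: (nnlsc_ge0 s nh).
    + exact: (nnlsc_measurable nh).
    apply: ge0_le_integral => //.
    + by move=> s _; rewrite mule_ge0 ?lee_fin ?wgt_ge0//; exact: (nnlsc_ge0 s nh).
    + apply: (nnlsc_measurable (nnlscM nh (nnlsc_cst _))).
      by rewrite lee_fin wgt_ge0.
    + apply: nnlsc_measurable; apply: (nnlsc_comp (phi := fun s : R => (s, y)) _ nH).
      by apply: continuous_pair => s; [exact: cvg_id|exact: cvg_cst].
    + move=> s _; rewrite /heatE /H/=; case: ifPn => s0; last by rewrite mul0e.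
      rewrite -EFinM lee_fin /heat/= /h /h1.
      rewrite [X in expR (- s) * X](_ : _ = (Num.sqrt (4 * pi * s))^-1 ^+ n *
        expR (- (sqn y / (4 * s))) * \prod_(i < n) (D * (expR (c * y ord0 i) +
          expR (- (c * y ord0 i))))); last first.
        rewrite (eq_bigr _ (fun i _ => esym (mulrA _ _ _))) !big_split/=.
        rewrite prodr_const card_ord -expR_sum; congr (_ * expR _ * _).
        - by rewrite sumrN /sqn mulr_suml.
        - by rewrite mulrC.
      rewrite [X in X * expR (- _) * _]mulrC -!mulrA ler_wpM2l ?expR_ge0//.
      rewrite ler_wpM2l ?exprn_ge0 ?invr_ge0 ?sqrtr_ge0// ler_wpM2l ?expR_ge0//.
      apply: le_trans (wgt_prod _ a0) _.
      by apply: ler_prod => i _; rewrite powR_ge0 DP.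
rewrite intRn_swap//.
have nI : nnlsc (fun s => intRn (fun y => H (s, y))) by exact: (nnlsc_intRn nH).
have D20 : 0 <= (2 * D) ^+ n * 2 by rewrite mulr_ge0// exprn_ge0// mulr_ge0.
have mE : measurable_fun [set: measurableTypeR R] (fun s => (exponential_pdf (1 / 2 : R) s)%:E).
  by apply/measurable_EFinP; exact: measurable_exponential_pdf.
have E0 s : 0 <= exponential_pdf (1 / 2 : R) s by exact: exponential_pdf_ge0.
(* The factor 2 compensates for the exponential density of rate 1/2 being exp(- s / 2) / 2 on s >=
   0. *)
apply: (@le_trans _ _ (\int[mu]_s (((2 * D) ^+ n * 2)%:E * (exponential_pdf (1 / 2 : R) s)%:E))%E).
  apply: ge0_le_integral => //.
  - by move=> s _; exact: (nnlsc_ge0 s nI).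
  - exact: (nnlsc_measurable nI).
  - exact: measurable_funeM.
  move=> s _; have [s0|s0] := ltP 0 s; last first.
    rewrite (eq_intRn (g := fun=> 0%E)) ?intRn0.
      by rewrite mule_ge0 ?lee_fin.
    by move=> y; rewrite /H/= ltNge s0.
  have hs : continuous (h s).
    by move=> t; apply: (ch _ (fun=> s) id) => //; exact: cvg_cst.
  rewrite (eq_intRn (g := fun y => (expR (- s))%:E * (\prod_(i < n) h s (y ord0 i))%:E)%E); last first.
    by move=> y; rewrite /H/= s0.
  rewrite intRnZ ?expR_ge0//; last first.
    apply: nnlsc_EFin => [y|y]; last by rewrite prodr_ge0.
    apply: continuous_for_prod => i.
    exact: (continuous_compT (@coord_continuous _ _ _ _ _) hs).
  rewrite (@intRn_prod _ n (h s) (2 * expR (c ^+ 2 * s) * D))//; first last.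
  - under eq_integral do rewrite EFinM.
    rewrite ge0_integralZr ?gauss_cosh//.
    + apply: (nnlsc_measurable (nnlsc_EFin _ (h10 s))) => t.
      by apply: (ch1 _ (fun=> s) id) => //; exact: cvg_cst.
    + by move=> t _; rewrite lee_fin.
  - by rewrite !mulr_ge0 ?expR_ge0.
  rewrite (exponential_pdfE _ (ltW s0)) -!EFinM lee_fin.
  rewrite [2 * _ * D]mulrAC exprMn -expRM_natl mulrCA -expRD -[leRHS]mulrA.
  rewrite ler_wpM2l ?exprn_ge0 ?mulr_ge0//.
  rewrite [leRHS](_ : _ = expR (- (1 / 2) * s)); last by field.
  rewrite ler_expR.
  have nc : n%:R * c ^+ 2 <= 1 / 2.
    rewrite /c exprVn ler_pdivrMr ?exprn_gt0//.
    by rewrite -(natr1 n); have := sqr_ge0 (n%:R : R); rewrite !expr2; lra.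
  nra.
rewrite ge0_integralZl//.
- by rewrite integral_exponential_pdf ?mule1// divr_gt0.
- by move=> s _; rewrite lee_fin.
Qed.

End bessel_kernel.

(** * The Bessel potential operator *)

Section bessel_operator.
Context {R : realType} (n : nat).
Implicit Types x y h : 'rV[R]_n.
Local Notation B := (@bessel_op R n).

Lemma continuous_subx x : continuous (fun y => x - y).
Proof. by move=> y; exact: (cvgB (cvg_cst x) (@cvg_id _ (nbhs y))). Qed.

Lemma nnlsc_kernel x : nnlsc (fun y => bessel_kernel (x - y)).
Proof. exact: (nnlsc_comp (@continuous_subx x) (@nnlsc_bessel_kernel R n)). Qed.

Lemma le_bessel_op (f g : 'rV[R]_n -> \bar R) x : nnlsc f -> nnlsc g ->
  (forall y, f y <= g y)%E -> (B f x <= B g x)%E.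
Proof.
move=> nf ng fg; have nB := nnlsc_kernel x.
apply: le_intRn; [exact: (nnlscM nB nf)|exact: (nnlscM nB ng)|].
by move=> y; apply: lee_wpmul2l => //; exact: (nnlsc_ge0 y nB).
Qed.

Lemma nnlsc_bessel_op_param (X : pseudoMetricType R) (f : X * 'rV[R]_n -> \bar R) :
  nnlsc f -> nnlsc (fun z : X * 'rV[R]_n => B (fun y => f (z.1, y)) z.2).
Proof.
move=> nf.
apply: (nnlsc_intRn (f := fun w : (X * 'rV[R]_n) * 'rV[R]_n =>
  (bessel_kernel (w.1.2 - w.2) * f (w.1.1, w.2))%E)).
have c12 := continuous_compT (@continuous_fst (X * 'rV[R]_n)%type 'rV[R]_n) (@continuous_snd _ _).
have c11 := continuous_compT (@continuous_fst (X * 'rV[R]_n)%type 'rV[R]_n) (@continuous_fst _ _).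
apply: nnlscM.
  apply: (nnlsc_comp (phi := fun w : (X * 'rV[R]_n) * 'rV[R]_n => w.1.2 - w.2) _
    (@nnlsc_bessel_kernel R n)).
  by move=> z; exact: (cvgB (c12 z) (@continuous_snd _ _ z)).
apply: (nnlsc_comp (phi := fun w : (X * 'rV[R]_n) * 'rV[R]_n => (w.1.1, w.2)) _ nf).
by apply: continuous_pair => //; exact: continuous_snd.
Qed.

Lemma nnlsc_iter_bessel_param (X : pseudoMetricType R) (f : X * 'rV[R]_n -> \bar R) k :
  nnlsc f -> nnlsc (fun z : X * 'rV[R]_n => iter k B (fun y => f (z.1, y)) z.2).
Proof.
move=> nf; elim: k => [|k IH] /=.
  by rewrite (_ : (fun _ => _) = f)//; apply/funext => -[].
exact: (nnlsc_bessel_op_param IH).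
Qed.

Lemma nnlsc_iter_bessel (f : 'rV[R]_n -> \bar R) k : nnlsc f -> nnlsc (iter k B f).
Proof.
move=> nf.
have nf' : nnlsc (fun z : R * 'rV[R]_n => f z.2) by exact: (nnlsc_comp (@continuous_snd _ _) nf).
exact: (nnlsc_sec 0 (nnlsc_iter_bessel_param k nf')).
Qed.

Lemma bessel_opZ (c : R) (f : 'rV[R]_n -> \bar R) x : 0 <= c -> nnlsc f ->
  B (fun y => c%:E * f y)%E x = (c%:E * B f x)%E.
Proof.
move=> c0 nf; rewrite /bessel_op -intRnZ//; last exact: (nnlscM (nnlsc_kernel x) nf).
by apply: eq_intRn => y; rewrite muleCA.
Qed.

(** Here c may be +oo, as a value of the kernel can be. In that case l = 0 is treated apart: all
    terms then vanish and 0 * oo = 0. *)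
Lemma ndcvg_mule (c l : \bar R) (u : nat -> \bar R) : (0 <= c)%E -> (forall k, 0 <= u k)%E ->
  ndcvg u l -> ndcvg (fun k => c * u k)%E (c * l)%E.
Proof.
move=> c0 u0 [ndu ul]; split; first by move=> k m km; apply: lee_wpmul2l => //; exact: ndu.
move: c c0 => [c| |]// c0; first exact: cvgeZl.
have [l0|l0] := eqVneq l 0%E; last by apply: (cvgeM _ (cvg_cst _) ul); exact: mule_def_infty_neq0.
rewrite l0 mule0 (_ : (fun _ => _) = fun=> 0%E); first exact: cvg_cst.
apply/funext => k; rewrite (_ : u k = 0%E) ?mule0//; apply/eqP.
by rewrite eq_le u0 andbT -l0; apply: ndcvg_le; split.
Qed.

Lemma ndcvg_bessel_op (f : nat -> 'rV[R]_n -> \bar R) g x : (forall k, nnlsc (f k)) ->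
  (forall y, ndcvg (f ^~ y) (g y)) -> ndcvg (fun k => B (f k) x) (B g x).
Proof.
move=> nf fg; apply: ndcvg_intRn => [k|y].
  exact: (nnlscM (nnlsc_kernel x) (nf k)).
apply: ndcvg_mule => //; first exact: (nnlsc_ge0 y (nnlsc_kernel x)).
by move=> k; exact: nnlsc_ge0.
Qed.

Lemma ndcvg_iter_bessel (f : nat -> 'rV[R]_n -> \bar R) g j x : (forall k, nnlsc (f k)) ->
  (forall y, ndcvg (f ^~ y) (g y)) ->
  ndcvg (fun k => iter j B (f k) x) (iter j B g x).
Proof.
move=> nf fg; elim: j x => [|j IH] x /=; first exact: fg.
by apply: ndcvg_bessel_op => // k; exact: nnlsc_iter_bessel.
Qed.

(** A Peetre-type factor comparing 1 + |x + h|^2 with 1 + |x|^2. Unlike the usual 2 (1 + |h|^2) it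
    tends to 1 as h tends to 0, which yields upper semicontinuity of B w and not only a bound. *)
Definition shift_factor (h : 'rV[R]_n) : R := 1 + \sum_(i < n) (`|h ord0 i| + h ord0 i ^+ 2).

Lemma shift_factor_ge1 h : 1 <= shift_factor h.
Proof. by rewrite lerDl sumr_ge0// => i _; rewrite addr_ge0// sqr_ge0. Qed.

Lemma continuous_shift_factor : continuous shift_factor.
Proof.
have cS : continuous (fun h => \sum_(i < n) (`|h ord0 i| + h ord0 i ^+ 2)).
  apply: continuous_sum => i h.
  have ci := @coord_continuous R 1 n ord0 i h.
  have c1 : {for h, continuous (fun h : 'rV[R]_n => `|h ord0 i|)}.
    exact (cvg_norm ci).
  exact: (cvgD c1 (cvgM ci ci)).
by move=> h; exact (cvgD (cvg_cst _) (cS h)).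
Qed.

(** Coordinatewise, 2 x_i h_i <= |h_i| (x_i^2 + 1), and x_i^2 <= |x|^2. *)
Lemma sqn_add x h : 1 + sqn (x + h) <= shift_factor h * (1 + sqn x).
Proof.
rewrite /shift_factor mulrDl mul1r -addrA lerD2l mulr_suml /sqn -big_split/=.
apply: ler_sum => i _; rewrite mxE -/(sqn x).
have xi : x ord0 i ^+ 2 <= sqn x.
  by rewrite /sqn (bigD1 i)//= lerDl sumr_ge0// => j _; exact: sqr_ge0.
have h0 := normr_ge0 (h ord0 i).
have hh : 2 * (x ord0 i * h ord0 i) <= `|h ord0 i| * (x ord0 i ^+ 2 + 1).
  apply: (@le_trans _ _ (`|h ord0 i| * (2 * `|x ord0 i|))).
    rewrite (mulrC `|h _ _|) -mulrA -normrM ler_wpM2l//; exact: ler_norm.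
  rewrite ler_wpM2l//; have := sqr_ge0 (`|x ord0 i| - 1); rewrite sqrrB.
  by rewrite real_normK ?num_real// mulr1 expr1n; lra.
have := sqn_ge0 x; move: xi hh h0 (sqr_ge0 (h ord0 i)).
rewrite sqrrD; move: (sqn x) `|h ord0 i| => Q H xi hh h0 h20 Q0; nra.
Qed.

Lemma shift_factor_le x : shift_factor x <= (n%:R + 2) * (1 + sqn x).
Proof.
have -> : (n%:R + 2) * (1 + sqn x) = 1 + (n%:R + sqn x + sqn x + (1 + n%:R * sqn x)) by ring.
rewrite lerD2l ler_wpDr ?addr_ge0 ?mulr_ge0 ?sqn_ge0//.
have -> : n%:R = \sum_(i < n) (1 : R) by rewrite sumr_const card_ord.
rewrite /sqn -!big_split/=; apply: ler_sum => i _; rewrite lerD2r.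
have := sqr_ge0 (`|x ord0 i| - 1); rewrite sqrrB.
by rewrite real_normK ?num_real// mulr1 expr1n; have := normr_ge0 (x ord0 i); lra.
Qed.

Lemma wgt_add a x h : 0 <= a ->
  wgt a (x + h) <= powR (shift_factor h) (a / 2) * wgt a x.
Proof.
move=> a0; have s0 : 0 <= shift_factor h := le_trans ler01 (shift_factor_ge1 h).
have q0 : 0 <= 1 + sqn x by rewrite addr_ge0// sqn_ge0.
rewrite -powRM//; apply: ge0_ler_powR; rewrite ?nnegrE ?divr_ge0//.
- by rewrite addr_ge0// sqn_ge0.
- exact: mulr_ge0.
- exact: sqn_add.
Qed.

Lemma nnlsc_wgt a : nnlsc (fun x => (wgt a x)%:E).
Proof. by apply: nnlsc_EFin; [exact: continuous_wgt|move=> x; exact: wgt_ge0]. Qed.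

Local Notation bw a := (B (fun y => (wgt a y)%:E)).

Lemma bessel_wgtE a x :
  bw a x = intRn (fun z => bessel_kernel z * (wgt a (x + z))%:E)%E.
Proof.
rewrite /bessel_op -(intRn_shift x (nnlscM (nnlsc_kernel x) (nnlsc_wgt a))).
by apply: eq_intRn => z; rewrite opprD addrCA subrr addr0 bessel_kernelN [z + x]addrC.
Qed.

(** After the change of variables in [bessel_wgtE] the translation acts on the weight alone, where
    [wgt_add] controls it pointwise. *)
Lemma bessel_wgt_shift a x h : 0 <= a ->
  (bw a (x + h)%R <= (powR (shift_factor h) (a / 2))%:E * bw a x)%E.
Proof.
move=> a0; have nw z : nnlsc (fun y => bessel_kernel y * (wgt a (z + y))%:E)%E.
  apply: (nnlscM (@nnlsc_bessel_kernel R n)).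
  apply: (nnlsc_comp (phi := fun y => z + y) _ (nnlsc_wgt a)).
  by move=> y; exact: (cvgD (cvg_cst z) (@cvg_id _ (nbhs y))).
rewrite !bessel_wgtE -intRnZ ?powR_ge0//; apply: le_intRn => //.
  by apply: nnlscZ => //; exact: powR_ge0.
move=> y; rewrite muleCA lee_wpmul2l//; first exact: (nnlsc_ge0 y (@nnlsc_bessel_kernel R n)).
by rewrite -EFinM lee_fin addrAC; exact: wgt_add.
Qed.

(** The shift estimate is used from the origin: B w (0 + x) is at most a power of the shift factor
    of x times B w (0), and B w (0) is the finite moment of the kernel. *)
Lemma bessel_wgt_bound a : 0 <= a -> exists2 K, 0 < K &
  forall x, (bw a x <= (K * wgt a x)%:E)%E.
Proof.
move=> a0; have [C CP] := @bessel_moment R n a a0.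
have C0 : 0 <= C.
  rewrite -lee_fin; apply: le_trans CP; apply: intRn_ge0 => y.
  by rewrite mule_ge0 ?lee_fin ?wgt_ge0//; exact: (nnlsc_ge0 y (@nnlsc_bessel_kernel R n)).
(* C + 1 in place of C keeps K strictly positive; K is a divisor later on. *)
exists (powR (n%:R + 2) (a / 2) * (C + 1)).
  by rewrite mulr_gt0 ?powR_gt0 ?ltr_wpDl.
move=> x; rewrite -[x in bw a x]add0r; apply: (le_trans (bessel_wgt_shift 0 x a0)).
apply: (@le_trans _ _ ((powR (shift_factor x) (a / 2))%:E * C%:E)%E).
  apply: lee_wpmul2l; first by rewrite lee_fin powR_ge0.
  rewrite bessel_wgtE (eq_intRn (g := fun y => bessel_kernel y * (wgt a y)%:E)%E)//.
  by move=> y; rewrite add0r.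
have q0 : 0 <= 1 + sqn x by rewrite addr_ge0// sqn_ge0.
rewrite -EFinM lee_fin mulrAC -powRM ?addr_ge0 ?sqn_ge0//.
apply: ler_pM; rewrite ?powR_ge0// ?lerDl//.
apply: ge0_ler_powR; rewrite ?nnegrE ?divr_ge0//.
- exact: le_trans ler01 (shift_factor_ge1 x).
- by rewrite mulr_ge0// addr_ge0.
- exact: shift_factor_le.
Qed.

End bessel_operator.

(** * Weighted bounds and upper semicontinuity *)

Section bessel_bounds.
Local Opaque bessel_kernel.
Context {R : realType} (n : nat) (a K : R).
Hypothesis (a0 : 0 <= a) (K0 : 0 < K).
Local Notation B := (@bessel_op R n).
Hypothesis wK : forall x, (B (fun y => (wgt a y)%:E) x <= (K * wgt a x)%:E)%E.

Lemma bessel_bound (M : R) (f : 'rV[R]_n -> \bar R) x : 0 <= M -> nnlsc f ->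
  (forall y, f y <= (M * wgt a y)%:E)%E -> (B f x <= (M * K * wgt a x)%:E)%E.
Proof.
move=> M0 nf fM.
apply: (@le_trans _ _ (B (fun y => M%:E * (wgt a y)%:E)%E x)).
  by apply: le_bessel_op => //; apply: nnlscZ => //; exact: nnlsc_wgt.
rewrite bessel_opZ//; last exact: nnlsc_wgt.
by rewrite -mulrA EFinM lee_wpmul2l ?lee_fin.
Qed.

Lemma iter_bessel_bound (M : R) (f : 'rV[R]_n -> \bar R) k x : 0 <= M -> nnlsc f ->
  (forall y, f y <= (M * wgt a y)%:E)%E ->
  (iter k B f x <= (M * K ^+ k * wgt a x)%:E)%E.
Proof.
move=> M0 nf fM; elim: k x => [|k IH] x; first by rewrite expr0 mulr1.
rewrite iterS exprSr mulrA; apply: bessel_bound => //.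
  by rewrite mulr_ge0// exprn_ge0// ltW.
exact: nnlsc_iter_bessel.
Qed.

Lemma fin_num_le (u : \bar R) (r : R) : (0 <= u)%E -> (u <= r%:E)%E -> u \is a fin_num.
Proof. by move=> u0 ur; rewrite ge0_fin_numE// (le_lt_trans ur)// ltry. Qed.

Lemma mine_lel (u v : \bar R) : (mine u v <= u)%E.
Proof. by rewrite ge_min lexx. Qed.

Lemma mine_ler (u v : \bar R) : (mine u v <= v)%E.
Proof. by rewrite ge_min lexx orbT. Qed.

(** For finite values this is (k' - k) (M w - f) >= 0. It is written without subtraction because k'
    may be infinite, in which case the right side is +oo. *)
Lemma kernel_min_le (k k' f : \bar R) (M w : R) : 0 < M -> 0 < w ->
  (0 <= k)%E -> (k <= k')%E -> (0 <= f)%E -> (f <= (M * w)%:E)%E ->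
  (k' * f + M%:E * (k * w%:E) <= k * f + M%:E * (k' * w%:E))%E.
Proof.
move=> M0 w0 k0 kk' f0 fM; case: f f0 fM => [r| |]//; rewrite !lee_fin => r0 rM.
have k'0 := le_trans k0 kk'.
case: k' kk' k'0 => [k'| |]//.
  case: k k0 => [k| |]// k0 kk' k'0.
  rewrite !lee_fin in k0 kk' k'0.
  rewrite -!EFinM -!EFinD lee_fin.
  have : 0 <= (k' - k) * (M * w - r) by rewrite mulr_ge0// subr_ge0.
  by lra.
move=> _ _; rewrite [X in (_ <= _ + _ * X)%E]gt0_mulye ?lte_fin//.
rewrite gt0_muley ?lte_fin// addey ?leey//.
by rewrite gt_eqF// (lt_le_trans ltNy0)// mule_ge0// lee_fin.
Qed.

Lemma usc_gap (u u' b b' I : \bar R) (M e : R) : 0 < M ->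
  b \is a fin_num -> b' \is a fin_num -> I \is a fin_num ->
  (u' + M%:E * I <= u + M%:E * b')%E ->
  ((fine b - e / 2)%:E < I)%E -> fine b' <= fine b + e / 2 ->
  (u' <= u + (M * e)%:E)%E.
Proof.
case: b b' I => [b| |]// [b'| |]// [I| |]// M0 _ _ _ /= key; rewrite lte_fin => bI b'b.
rewrite -(@leeD2rE _ (M * I)%:E)//; apply: (le_trans key).
rewrite -addeA leeD2l// -EFinD lee_fin -mulrDr ler_wpM2l ?(ltW M0)//.
by lra.
Qed.

(* Scheffe's argument: with m the minimum of the two translated kernels, the lower
   semicontinuity of the integral of m * w and the continuity of B w force the
   integral of (B(x' - y) - m) w to vanish as x' tends to x. *)
Lemma bessel_usc x (e : R) : 0 < e -> \forall x' \near x,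
  forall M (f : 'rV[R]_n -> \bar R), 0 < M -> nnlsc f ->
    (forall y, f y <= (M * wgt a y)%:E)%E -> (B f x' <= B f x + (M * e)%:E)%E.
Proof.
move=> e0; pose w := (fun y : 'rV[R]_n => (wgt a y)%:E).
pose m x' y := mine (bessel_kernel (x' - y)) (@bessel_kernel R n (x - y)).
have nw : nnlsc w := @nnlsc_wgt R n a.
have nm x' : nnlsc (m x') by apply: nnlsc_min; exact: nnlsc_kernel.
have bwfin x' : B w x' \is a fin_num.
  apply: (fin_num_le _ (wK x')); apply: intRn_ge0 => y.
  exact: (nnlsc_ge0 y (nnlscM (nnlsc_kernel x') nw)).
have nearm : \forall x' \near x, ((fine (B w x) - e / 2)%:E < intRn (fun y => m x' y * w y))%E.
  have nI : nnlsc (fun x' => intRn (fun y => m x' y * w y)%E).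
    apply: (nnlsc_intRn (f := fun z : 'rV[R]_n * 'rV[R]_n => m z.1 z.2 * w z.2)%E).
    apply: nnlscM; last exact: (nnlsc_comp (@continuous_snd _ _) nw).
    apply: nnlsc_min.
      apply: (nnlsc_comp (phi := fun z : 'rV[R]_n * 'rV[R]_n => z.1 - z.2) _ (@nnlsc_bessel_kernel R n)).
      by move=> z; exact: (cvgB (@continuous_fst _ _ z) (@continuous_snd _ _ z)).
    exact: (nnlsc_comp (@continuous_snd _ _) (nnlsc_kernel x)).
  apply: (nnlsc_near nI).
  have -> : intRn (fun y => m x y * w y)%E = B w x.
    by apply: eq_intRn => y; rewrite /m minxx.
  by rewrite -[in ltRHS](fineK (bwfin x)) lte_fin gtrBl divr_gt0.
have nearb : \forall x' \near x, (fine (B w x') <= fine (B w x) + e / 2).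
  have c : continuous (fun x' : 'rV[R]_n => powR (shift_factor (x' - x)) (a / 2) * fine (B w x)).
    have cs : continuous (fun x' : 'rV[R]_n => shift_factor (x' - x)).
      apply: (continuous_compT (f := fun x' : 'rV[R]_n => x' - x) _ (@continuous_shift_factor R n)).
      by move=> x'; exact: (cvgB (@cvg_id _ (nbhs x')) (cvg_cst x)).
    have cp := continuous_powR_gt0 (b := a / 2) cs (fun x' => lt_le_trans ltr01 (shift_factor_ge1 _)).
    by move=> x'; exact: (cvgM (cp x') (cvg_cst _)).
  have : \forall x' \near x, powR (shift_factor (x' - x)) (a / 2) * fine (B w x) < fine (B w x) + e / 2.
    apply: (c x [set r | r < fine (B w x) + e / 2]).
    apply: lt_nbhsl.
    rewrite subrr /shift_factor big1 ?addr0 ?powR1 ?mul1r ?ltrDl ?divr_gt0// => i _.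
    by rewrite mxE normr0 expr0n addr0.
  apply: filterS => x' /ltW; apply: le_trans.
  have h : (B w (x + (x' - x))%R <= (powR (shift_factor (x' - x)) (a / 2))%:E * B w x)%E.
    exact: bessel_wgt_shift.
  rewrite subrKC in h; move: (bwfin x) (bwfin x') h.
  by case: (B w x') => [b'| |]//; case: (B w x) => [b| |].
near=> x' => M f M0 nf fM.
have nk := nnlsc_kernel x'.
have m0 y : (0 <= m x' y)%E by exact: nnlsc_ge0.
have mw : (intRn (fun y => m x' y * w y) <= B w x')%E.
  apply: le_intRn; [exact: (nnlscM (nm x') nw)|exact: (nnlscM nk nw)|move=> y].
  by apply: lee_wpmul2r; [exact: (nnlsc_ge0 y nw)|exact: mine_lel].
have mfin : (intRn (fun y => m x' y * w y) \is a fin_num)%E.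
  rewrite -(fineK (bwfin x')) in mw; apply: fin_num_le mw.
  by apply: intRn_ge0 => y; exact: (nnlsc_ge0 y (nnlscM (nm x') nw)).
(* [kernel_min_le] is applied with k the minimum m and k' the kernel centred at x'; on the right, m
   is then replaced by the larger kernel centred at x. The neighbourhood of x was fixed before f and
   M, which makes the estimate uniform. *)
have key : (B f x' + M%:E * intRn (fun y => m x' y * w y) <= B f x + M%:E * B w x')%E.
  rewrite /bessel_op -!intRnZ ?(ltW M0)//; [|exact: (nnlscM nk nw)|exact: (nnlscM (nm x') nw)].
  apply: (@le_trans _ _ (intRn (fun y => m x' y * f y) +
      intRn (fun y => M%:E * (bessel_kernel (x' - y)%R * w y)))%E); last first.
    rewrite leeD2r//; apply: le_intRn; [exact: (nnlscM (nm x') nf)|exact: (nnlscM (nnlsc_kernel x) nf)|].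
    by move=> y; apply: lee_wpmul2r; [exact: (nnlsc_ge0 y nf)|exact: mine_ler].
  have nMk := nnlscZ (ltW M0) (nnlscM nk nw).
  have nMm := nnlscZ (ltW M0) (nnlscM (nm x') nw).
  rewrite -!intRnD//; [|exact: (nnlscM (nm x') nf)|exact: (nnlscM nk nf)].
  apply: le_intRn; [exact: (nnlscD (nnlscM nk nf) nMm)|exact: (nnlscD (nnlscM (nm x') nf) nMk)|].
  move=> y; apply: kernel_min_le => //; [exact: wgt_gt0| |exact: nnlsc_ge0].
  exact: mine_lel.
apply: (usc_gap M0 (bwfin x) (bwfin x') mfin key); near: x'; [exact: nearm|exact: nearb].
Unshelve. all: by end_near. Qed.

End bessel_bounds.

(** * Poisson sums *)

Section poisson_sums.
Context {R : realType}.
Implicit Types (t : R) (g : nat -> \bar R).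

Definition pois t k : R := expR (- t) * t ^+ k / (k`!)%:R.

Definition psum t g : \bar R := (\sum_(0 <= k <oo) (pois t k)%:E * g k)%E.

Lemma pois_ge0 t k : 0 <= t -> 0 <= pois t k.
Proof. by move=> t0; rewrite divr_ge0// mulr_ge0 ?expR_ge0// exprn_ge0. Qed.

Lemma psum_term_ge0 t g k : 0 <= t -> (0 <= g k)%E -> (0 <= (pois t k)%:E * g k)%E.
Proof. by move=> t0 g0; rewrite mule_ge0 ?lee_fin ?pois_ge0. Qed.

Lemma le_psum t g h : 0 <= t -> (forall k, 0 <= g k)%E -> (forall k, g k <= h k)%E ->
  (psum t g <= psum t h)%E.
Proof.
move=> t0 g0 gh; apply: lee_nneseries => [k _ _|k _]; first exact: psum_term_ge0.
by rewrite lee_wpmul2l ?lee_fin ?pois_ge0.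
Qed.

Lemma psumD t g h : 0 <= t -> (forall k, 0 <= g k)%E -> (forall k, 0 <= h k)%E ->
  psum t (fun k => g k + h k)%E = (psum t g + psum t h)%E.
Proof.
move=> t0 g0 h0; rewrite /psum -nneseriesD; last 2 first.
- by move=> k _ _; exact: psum_term_ge0.
- by move=> k _ _; exact: psum_term_ge0.
by apply: eq_eseriesr => k _; rewrite ge0_muleDr.
Qed.

Lemma exp_partial_le (x : R) N : 0 <= x -> \sum_(0 <= k < N) x ^+ k / (k`!)%:R <= expR x.
Proof.
move=> x0; rewrite -[leLHS]/(series (exp_coeff x) N).
apply: nondecreasing_cvgn_le; last exact: is_cvg_series_exp_coeff.
by apply: nondecreasing_series => *; exact: exp_coeff_ge0.
Qed.

(** The sum is D exp((K - 1) t); the factor exp(- t) <= 1 is simply dropped. *)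
Lemma psum_bound t (D K : R) : 0 <= t -> 0 <= D -> 0 <= K ->
  (psum t (fun k => (D * K ^+ k)%:E) <= (D * expR (K * t))%:E)%E.
Proof.
move=> t0 D0 K0; apply: lime_le.
  apply: is_cvg_nneseries => k _ _.
  by rewrite -EFinM lee_fin !mulr_ge0 ?pois_ge0 ?exprn_ge0.
apply: nearW => N; rewrite sumEFin lee_fin.
apply: (@le_trans _ _ (\sum_(0 <= k < N) D * ((K * t) ^+ k / (k`!)%:R))).
  apply: ler_sum => k _.
  have -> : pois t k * (D * K ^+ k) = expR (- t) * (D * ((K * t) ^+ k / (k`!)%:R)).
    by rewrite /pois exprMn; field; rewrite pnatr_eq0 -lt0n fact_gt0.
  apply: ler_piMl; last by rewrite -expR0 ler_expR oppr_le0.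
  by rewrite mulr_ge0// divr_ge0// exprn_ge0// mulr_ge0.
by rewrite -mulr_sumr ler_wpM2l// exp_partial_le// mulr_ge0.
Qed.

(** exp(t) [pois t k] = t^k / k! is nondecreasing in t. This is the source of the monotonicity of
    e^t u(t). *)
Lemma psum_le_expR t t' g : 0 <= t -> t <= t' -> (forall k, 0 <= g k)%E ->
  (psum t g <= (expR (t' - t))%:E * psum t' g)%E.
Proof.
move=> t0 tt' g0; rewrite /psum -nneseriesZl; last first.
  by move=> k _; apply: psum_term_ge0 => //; exact: le_trans tt'.
apply: lee_nneseries => [k _ _|k _]; first exact: psum_term_ge0.
rewrite muleA -EFinM lee_wpmul2r// lee_fin /pois !mulrA -expRD.
rewrite (_ : t' - t - t' = - t); last by ring.
by rewrite ler_wpM2r// ler_wpM2l ?expR_ge0// lerXn2r ?nnegrE// (le_trans t0).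
Qed.

Lemma exprS_diff (t t' : R) k : 0 <= t -> t <= t' ->
  t' ^+ k.+1 <= t ^+ k.+1 + k.+1%:R * (t' - t) * t' ^+ k.
Proof.
move=> t0 tt'; have t'0 := le_trans t0 tt'; elim: k => [|k IH].
  by rewrite !expr1 expr0 mul1r mulr1; lra.
rewrite exprS; apply: le_trans (ler_wpM2l t'0 IH) _.
rewrite mulrDr [t' * (_ * _ * _)]mulrCA -exprS.
have : (t' - t) * t ^+ k.+1 <= (t' - t) * t' ^+ k.+1.
  by rewrite ler_wpM2l ?subr_ge0// lerXn2r ?nnegrE.
rewrite (exprS t k.+1) -(natr1 k.+1).
by move: (t ^+ k.+1) (t' ^+ k.+1) (k.+1%:R) => A C D; lra.
Qed.

(** The factor k + 1 turns 1 / (k+1)! into 1 / k!, so the increment is carried by the weight of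
    index k. *)
Lemma poisS_diff t t' k : 0 <= t -> t <= t' ->
  pois t' k.+1 <= pois t k.+1 + (t' - t) * pois t' k.
Proof.
move=> t0 tt'; rewrite /pois.
have -> : (t' - t) * (expR (- t') * t' ^+ k / k`!%:R) =
  expR (- t') * (k.+1%:R * (t' - t) * t' ^+ k) / (k.+1)`!%:R.
  have f0 : k`!%:R != 0 :> R by rewrite pnatr_eq0 -lt0n fact_gt0.
  have s0 : k.+1%:R != 0 :> R by rewrite pnatr_eq0.
  rewrite factS natrM; move: (k`!%:R) (k.+1%:R) f0 s0 => F S F0 S0.
  by field; rewrite F0 S0.
rewrite -mulrDl ler_wpM2r ?invr_ge0//.
apply: le_trans (ler_wpM2l (expR_ge0 _) (exprS_diff k t0 tt')) _.
rewrite mulrDr lerD2r ler_wpM2r ?exprn_ge0// ler_expR lerN2//.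
Qed.

(** With g k the k-th iterate of B, the shifted sequence is one more application of B. The time
    increment is thus controlled by the boundedness of B alone. *)
Lemma psum_le_add t t' g : 0 <= t -> t <= t' -> (forall k, 0 <= g k)%E ->
  (psum t' g <= psum t g + (t' - t)%:E * psum t' (fun k => g k.+1))%E.
Proof.
move=> t0 tt' g0; have t'0 := le_trans t0 tt'.
apply: lime_le; first by apply: is_cvg_nneseries => k _ _; exact: psum_term_ge0.
apply: nearW => N.
apply: (@le_trans _ _ (\sum_(0 <= k < N) (pois t k)%:E * g k +
   (t' - t)%:E * \sum_(0 <= k < N) (pois t' k)%:E * g k.+1)%E); last first.
  apply: leeD.
    by apply: nneseries_lim_ge => k _ _; exact: psum_term_ge0.
  rewrite lee_wpmul2l ?lee_fin ?subr_ge0//.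
  by apply: nneseries_lim_ge => k _ _; rewrite mule_ge0 ?lee_fin ?pois_ge0.
case: N => [|N]; first by rewrite !big_geq// mule0 adde0.
rewrite ge0_sume_distrr; last by move=> k _; rewrite mule_ge0 ?lee_fin ?pois_ge0.
(* The term of index 0 has weight exp(- t), which decreases in t and needs no correction; the last
   term of the correction sum is discarded. *)
rewrite big_nat_recl// [in leRHS]big_nat_recl//= -addeA; apply: leeD.
  by rewrite lee_wpmul2r// lee_fin /pois !expr0 !mulr1 ler_wpM2r ?invr_ge0// ler_expR lerN2.
rewrite big_nat_recr//= addeA -[leLHS]adde0; apply: leeD; last first.
  by rewrite !mule_ge0 ?lee_fin ?subr_ge0 ?pois_ge0.
rewrite -big_split/=; apply: lee_sum => k _.
have p1 := pois_ge0 k.+1 t0; have p2 := pois_ge0 k t'0.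
have p3 : 0 <= (t' - t) * pois t' k by rewrite mulr_ge0// subr_ge0.
rewrite muleA -EFinM -ge0_muleDl ?lee_fin//.
by rewrite lee_wpmul2r// -EFinD lee_fin poisS_diff.
Qed.

Lemma ndcvgD (u v : nat -> \bar R) l m : (forall k, 0 <= u k)%E -> (forall k, 0 <= v k)%E ->
  ndcvg u l -> ndcvg v m -> ndcvg (fun k => u k + v k)%E (l + m)%E.
Proof.
move=> u0 v0 ul vm; split.
  by move=> i j ij; apply: leeD; [exact: ul.1|exact: vm.1].
apply: cvgeD; [|exact: ul.2|exact: vm.2].
by apply: ge0_adde_def; rewrite inE; [exact: le_trans (ndcvg_le 0 ul)|exact: le_trans (ndcvg_le 0 vm)].
Qed.

(** Monotone convergence for series: each finite partial sum passes to the limit, and the two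
    suprema commute. *)
Lemma ndcvg_sum_series (u : nat -> nat -> \bar R) (v : nat -> \bar R) :
  (forall k j, 0 <= u k j)%E -> (forall j, ndcvg (u ^~ j) (v j)) ->
  ndcvg (fun k => \sum_(0 <= j <oo) u k j)%E (\sum_(0 <= j <oo) v j)%E.
Proof.
move=> u0 uv.
have v0 j : (0 <= v j)%E by exact: le_trans (ndcvg_le 0 (uv j)).
have nd : nondecreasing_seq (fun k => \sum_(0 <= j <oo) u k j)%E.
  by move=> k m km; apply: lee_nneseries => // j _; exact: (uv j).1.
apply/ndcvgP; split => //; apply/eqP; rewrite eq_le; apply/andP; split; last first.
  apply: ge_ereal_sup => _ [k _ <-].
  by apply: lee_nneseries => // j _; exact: ndcvg_le (uv j).
apply: lime_le; first exact: is_cvg_nneseries.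
apply: nearW => J.
have : ndcvg (fun k => \sum_(0 <= j < J) u k j)%E (\sum_(0 <= j < J) v j)%E.
  elim: J => [|J IH].
    rewrite big_geq//; under eq_fun do rewrite big_geq//.
    by split; [move=> ? ? _|exact: cvg_cst].
  rewrite big_nat_recr//=; under eq_fun do rewrite big_nat_recr//=.
  by apply: ndcvgD => // k; exact: sume_ge0.
move=> /ndcvgP[_ ->]; apply: ge_ereal_sup => _ [k _ <-].
apply: (@le_trans _ _ (\sum_(0 <= j <oo) u k j)%E).
  exact: nneseries_lim_ge.
by apply: ereal_sup_ubound; exists k.
Qed.

Lemma ndcvg_psum t (u : nat -> nat -> \bar R) (v : nat -> \bar R) : 0 <= t ->
  (forall k j, 0 <= u k j)%E -> (forall j, ndcvg (u ^~ j) (v j)) ->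
  ndcvg (fun k => psum t (u k)) (psum t v).
Proof.
move=> t0 u0 uv; apply: ndcvg_sum_series => [k j|j]; first exact: psum_term_ge0.
by apply: ndcvg_mule => //; rewrite lee_fin pois_ge0.
Qed.

End poisson_sums.

(** * The Duhamel term *)

Section duhamel.
Context {R : realType} (n : nat).
Local Notation B := (@bessel_op R n).
Local Notation mu := (@lebesgue_measure R).
Local Opaque bessel_op.

Lemma ppart_ge0 (t : R) : 0 <= ppart t.
Proof. by rewrite /ppart le_max lexx orbT. Qed.

Lemma ppart_id (t : R) : 0 <= t -> ppart t = t.
Proof. by move=> t0; rewrite /ppart max_l. Qed.

Lemma ppart_le (t T : R) : 0 <= T -> t <= T -> ppart t <= T.
Proof. by move=> T0 tT; rewrite /ppart ge_max tT. Qed.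

Lemma continuous_ppart : continuous (@ppart R).
Proof. by move=> t; apply: continuous_max; [exact: cvg_id|exact: cvg_cst]. Qed.

(** The Green operator with time clamped at 0. For t < 0 the odd Poisson weights would be negative
    and positivity would be lost. *)
Definition gplus (t : R) (f : 'rV[R]_n -> \bar R) x : \bar R :=
  psum (ppart t) (fun k => iter k B f x).

Definition duham_term (F : R * 'rV[R]_n -> \bar R) t tau x : \bar R :=
  gplus (t - tau) (B (fun y => F (tau, y))) x.

(** The interval is open so that the set 0 < tau < t is open in (t, tau), and the integrand cut off
    to it stays lower semicontinuous. The closed interval of the mild equation differs by a null
    set. *)
Definition duham (F : R * 'rV[R]_n -> \bar R) t x : \bar R :=
  (\int[mu]_(tau in `]0%R, t[%classic) duham_term F t tau x)%E.

Lemma continuous_pois k : continuous (fun t : R => pois (ppart t) k).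
Proof.
have c1 : continuous (fun t : R => expR (- ppart t)).
  apply: (continuous_compT (f := fun t => - ppart t) _ (@continuous_expR R)) => t.
  exact (cvgN (@continuous_ppart t)).
have c2 : continuous (fun t : R => ppart t ^+ k).
  exact: (continuous_compT (g := fun r : R => r ^+ k) continuous_ppart (@exprn_continuous _ k)).
by move=> t; exact (cvgM (cvgM (c1 t) (c2 t)) (cvg_cst _)).
Qed.

Lemma nnlsc_gplus_param (X : pseudoMetricType R) (f : X * 'rV[R]_n -> \bar R) : nnlsc f ->
  nnlsc (fun z : (X * R) * 'rV[R]_n => gplus z.1.2 (fun y => f (z.1.1, y)) z.2).
Proof.
move=> nf; apply: nnlsc_series => k.
have c12 := continuous_compT (@continuous_fst (X * R)%type 'rV[R]_n) (@continuous_snd _ _).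
have c11 := continuous_compT (@continuous_fst (X * R)%type 'rV[R]_n) (@continuous_fst _ _).
apply: nnlscM.
  apply: nnlsc_EFin => [|z]; last by apply: pois_ge0; exact: ppart_ge0.
  exact: (continuous_compT c12 (@continuous_pois k)).
apply: (nnlsc_comp (phi := fun z : (X * R) * 'rV[R]_n => (z.1.1, z.2)) _
  (nnlsc_iter_bessel_param k nf)).
exact: (continuous_pair c11 (@continuous_snd _ _)).
Qed.

Lemma nnlsc_gplus (f : 'rV[R]_n -> \bar R) : nnlsc f ->
  nnlsc (fun z : R * 'rV[R]_n => gplus z.1 f z.2).
Proof.
move=> nf.
have nf' : nnlsc (fun z : R * 'rV[R]_n => f z.2) by exact: (nnlsc_comp (@continuous_snd _ _) nf).
apply: (nnlsc_comp (phi := fun z : R * 'rV[R]_n => ((0, z.1), z.2)) _ (nnlsc_gplus_param nf')).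
apply: continuous_pair; last exact: continuous_snd.
by apply: continuous_pair; [move=> z; exact: cvg_cst|exact: continuous_fst].
Qed.

Lemma nnlsc_duham_term F : nnlsc F ->
  nnlsc (fun z : (R * 'rV[R]_n) * R => duham_term F z.1.1 z.2 z.1.2).
Proof.
move=> nF; have nG := nnlsc_gplus_param (nnlsc_bessel_op_param nF).
have c12 := continuous_compT (@continuous_fst (R * 'rV[R]_n)%type R) (@continuous_snd _ _).
have c11 := continuous_compT (@continuous_fst (R * 'rV[R]_n)%type R) (@continuous_fst _ _).
apply: (nnlsc_comp (phi := fun z : (R * 'rV[R]_n) * R => ((z.2, z.1.1 - z.2), z.1.2)) _ nG).
apply: continuous_pair => //; apply: continuous_pair; first exact: continuous_snd.
by move=> z; exact (cvgB (c11 z) (@continuous_snd _ _ z)).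
Qed.

Lemma nnlsc_duham_sec F t x : nnlsc F -> nnlsc (fun tau => duham_term F t tau x).
Proof. by move=> nF; exact: (nnlsc_sec (t, x) (nnlsc_duham_term nF)). Qed.

Lemma nnlsc_duham F : nnlsc F -> nnlsc (fun z : R * 'rV[R]_n => duham F z.1 z.2).
Proof.
move=> nF; pose g (w : (R * 'rV[R]_n) * R) : \bar R :=
  if (0 < w.2) && (w.2 < w.1.1) then duham_term F w.1.1 w.2 w.1.2 else 0%E.
rewrite (_ : (fun _ => _) = fun z => (\int[mu]_tau g (z, tau))%E); last first.
  apply/funext => z; rewrite /duham integral_mkcond; apply: eq_integral => tau _.
  by rewrite patchE mem_setE in_itv.
have nT := nnlsc_duham_term nF.
apply: nnlsc_integral; apply: nnlsc_if => [|w _|w c _ cw].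
- have c11 := continuous_compT (@continuous_fst (R * 'rV[R]_n)%type R) (@continuous_fst _ _).
  rewrite (_ : [set _ | _] = (snd @^-1` [set s : R | 0 < s]) `&`
    ((fun w : (R * 'rV[R]_n) * R => w.1.1 - w.2) @^-1` [set s : R | 0 < s])); last first.
    by apply/seteqP; split => w /=; rewrite subr_gt0 => /andP.
  apply: openI; apply: open_comp; [move=> z _; exact: continuous_snd|exact: open_gt| |exact: open_gt].
  by move=> z _; exact (cvgB (c11 z) (@continuous_snd _ _ z)).
- exact: (nnlsc_ge0 w nT).
- exact: (nnlsc_near nT cw).
Qed.

Lemma iter_bessel_ge0 (f : 'rV[R]_n -> \bar R) k x : nnlsc f -> (0 <= iter k B f x)%E.
Proof. by move=> nf; exact: (nnlsc_ge0 x (nnlsc_iter_bessel k nf)). Qed.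

Lemma nnlsc_bessel_sec (F : R * 'rV[R]_n -> \bar R) tau : nnlsc F ->
  nnlsc (B (fun y => F (tau, y))).
Proof. by move=> nF; exact: (nnlsc_iter_bessel 1 (nnlsc_sec tau nF)). Qed.

Lemma le_iter_bessel (f g : 'rV[R]_n -> \bar R) k x : nnlsc f -> nnlsc g ->
  (forall y, f y <= g y)%E -> (iter k B f x <= iter k B g x)%E.
Proof.
move=> nf ng fg; elim: k x => [|k IH] x /=; first exact: fg.
by apply: le_bessel_op => //; exact: nnlsc_iter_bessel.
Qed.

Lemma le_duham F F' t x : nnlsc F -> nnlsc F' -> (forall z, F z <= F' z)%E ->
  (duham F t x <= duham F' t x)%E.
Proof.
move=> nF nF' FF'; apply: ge0_le_integral => //.
- by move=> tau _; exact: (nnlsc_ge0 tau (nnlsc_duham_sec t x nF)).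
- exact: (nnlsc_measurable (nnlsc_duham_sec t x nF)).
- exact: (nnlsc_measurable (nnlsc_duham_sec t x nF')).
move=> tau _; apply: le_psum; first exact: ppart_ge0.
  by move=> k; apply: iter_bessel_ge0; exact: nnlsc_bessel_sec.
move=> k; apply: le_iter_bessel; [exact: nnlsc_bessel_sec|exact: nnlsc_bessel_sec|].
by move=> y; apply: le_bessel_op => //; exact: nnlsc_sec.
Qed.

Lemma ndcvg_duham (F : nat -> R * 'rV[R]_n -> \bar R) F' t x : (forall k, nnlsc (F k)) ->
  (forall z, ndcvg (F ^~ z) (F' z)) -> ndcvg (fun k => duham (F k) t x) (duham F' t x).
Proof.
move=> nF FF'; apply: ndcvg_integral => //.
  by move=> k; exact: nnlsc_duham_sec.
move=> tau _; apply: ndcvg_psum; first exact: ppart_ge0.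
  by move=> k j; apply: iter_bessel_ge0; exact: nnlsc_bessel_sec.
move=> j; apply: (ndcvg_iter_bessel (f := fun k => B (fun y => F k (tau, y)))).
  by move=> k; exact: nnlsc_bessel_sec.
by move=> y; apply: ndcvg_bessel_op => // k; exact: nnlsc_sec.
Qed.

Lemma integral_le_cst (D : set R) (f : R -> \bar R) (d c : R) : measurable D ->
  (mu D <= d%:E)%E -> nnlsc f -> 0 <= c -> (forall s, D s -> f s <= c%:E)%E ->
  (\int[mu]_(s in D) f s <= (c * d)%:E)%E.
Proof.
move=> mD Dd nf c0 fc.
apply: (@le_trans _ _ (\int[mu]_(s in D) (cst c%:E s))%E).
  apply: ge0_le_integral => //.
  - by move=> s _; exact: nnlsc_ge0.
  - exact: nnlsc_measurable.
by rewrite integral_cst// EFinM lee_wpmul2l ?lee_fin.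
Qed.

Lemma lebesgue_itv_le (b0 b1 : bool) (s t : R) : s <= t ->
  (mu [set` Interval (BSide b0 s) (BSide b1 t)] <= (t - s)%:E)%E.
Proof.
move=> st; rewrite lebesgue_measure_itv/=; case: ifPn => _; first by rewrite -EFinD.
by rewrite lee_fin subr_ge0.
Qed.

Section bounds.
Context (a K : R).
Hypothesis (a0 : 0 <= a) (K0 : 0 < K).
Hypothesis wK : forall x, (B (fun y => (wgt a y)%:E) x <= (K * wgt a x)%:E)%E.

Lemma psum_iter_bound (M T t : R) f x : 0 <= M -> nnlsc f ->
  (forall y, f y <= (M * wgt a y)%:E)%E -> 0 <= t -> t <= T ->
  (psum t (fun k => iter k B f x) <= (M * expR (K * T) * wgt a x)%:E)%E.
Proof.
move=> M0 nf fM t0 tT.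
apply: (@le_trans _ _ (psum t (fun k => (M * wgt a x * K ^+ k)%:E))).
  apply: le_psum => // k; first exact: iter_bessel_ge0.
  by rewrite mulrAC; exact: (iter_bessel_bound K0 wK).
apply: le_trans (psum_bound t0 _ (ltW K0)) _; first by rewrite mulr_ge0// wgt_ge0.
by rewrite lee_fin mulrAC ler_wpM2r ?wgt_ge0// ler_wpM2l// ler_expR ler_wpM2l// ltW.
Qed.

Variables (T : R) (T0 : 0 <= T).

Section source.
Variables (N : R) (F : R * 'rV[R]_n -> \bar R).
Hypothesis (N0 : 0 < N) (nF : nnlsc F).
Hypothesis FN : forall tau, tau <= T -> forall y, (F (tau, y) <= (N * wgt a y)%:E)%E.

Lemma bessel_source_bound tau x : tau <= T ->
  (B (fun y => F (tau, y)) x <= (N * K * wgt a x)%:E)%E.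
Proof.
move=> tT; apply: (bessel_bound wK _ (ltW N0)) => [|y]; last exact: FN.
exact: nnlsc_sec.
Qed.

Lemma duham_term_bound t tau x : 0 <= tau -> tau < t -> t <= T ->
  (duham_term F t tau x <= (N * K * expR (K * T) * wgt a x)%:E)%E.
Proof.
move=> tau0 taut tT; have d0 : 0 <= t - tau by rewrite subr_ge0 ltW.
rewrite /duham_term /gplus ppart_id//; apply: psum_iter_bound => //.
- by rewrite mulr_ge0// ltW.
- exact: nnlsc_bessel_sec.
- by move=> y; apply: bessel_source_bound; exact: le_trans (ltW taut) tT.
- by rewrite (le_trans _ tT)// gerBl.
Qed.

Lemma duham_bound t x : t <= T ->
  (duham F t x <= (T * (N * K) * expR (K * T) * wgt a x)%:E)%E.
Proof.
move=> tT; have C0 : 0 <= N * K * expR (K * T) * wgt a x.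
  by rewrite !mulr_ge0 ?expR_ge0 ?wgt_ge0// ltW.
have [t0|t0] := leP t 0.
  rewrite /duham set_itv_ge ?integral_set0 ?lee_fin; last by rewrite -leNgt.
  by rewrite -!mulrA mulr_ge0// !mulrA.
apply: le_trans (integral_le_cst _ (lebesgue_itv_le _ _ (ltW t0)) (nnlsc_duham_sec t x nF) C0 _) _ => //.
  by move=> s /=; rewrite in_itv/= => /andP[s0 st]; exact: (duham_term_bound x (ltW s0)).
by rewrite subr0 lee_fin mulrC -!mulrA ler_wpM2r// !mulrA.
Qed.

(** [bessel_usc] gives one neighbourhood of x valid for every tau and every k. The k-th term has
    error N e K^k, and the Poisson sum of these errors converges. *)
Lemma duham_usc x (e : R) : 0 < e -> \forall x' \near x, forall t, 0 <= t -> t <= T ->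
  (duham F t x' <= duham F t x + (e * (N * expR (K * T)) * T)%:E)%E.
Proof.
move=> e0; have := bessel_usc a0 wK x e0; apply: filterS => x' usc t t0 tT.
pose C := e * (N * expR (K * T)).
have C0 : 0 <= C by rewrite !mulr_ge0 ?expR_ge0// ltW.
have nT z := nnlsc_duham_sec t z nF.
apply: (@le_trans _ _ (\int[mu]_(tau in `]0%R, t[%classic) (duham_term F t tau x + C%:E))%E).
  apply: ge0_le_integral => //.
  - by move=> tau _; exact: (nnlsc_ge0 tau (nT x')).
  - exact: (nnlsc_measurable (nT x')).
  - by apply: (nnlsc_measurable (nnlscD (nT x) (nnlsc_cst _))); rewrite lee_fin.
  move=> tau /=; rewrite in_itv/= => /andP[tau0 taut].
  have d0 : 0 <= t - tau by rewrite subr_ge0 ltW.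
  have tauT := le_trans (ltW taut) tT.
  rewrite /duham_term /gplus ppart_id//.
  apply: (@le_trans _ _ (psum (t - tau) (fun k => iter k B (B (fun y => F (tau, y))) x +
      (N * e * K ^+ k)%:E)%E)).
    apply: le_psum => // k; first by apply: iter_bessel_ge0; exact: nnlsc_bessel_sec.
    (* The B inside the Duhamel source is moved outermost, so that every term, including k = 0, is B
       applied to a function below N K^k w. *)
    rewrite -!iterSr !iterS [N * e * _]mulrAC; apply: usc.
    - by rewrite mulr_gt0// exprn_gt0.
    - by apply: nnlsc_iter_bessel; exact: nnlsc_sec.
    - move=> y; apply: (iter_bessel_bound K0 wK k y (ltW N0)); first exact: nnlsc_sec.
      exact: FN.
  have NeK k : 0 <= N * e * K ^+ k by rewrite !mulr_ge0 ?exprn_ge0// ltW.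
  rewrite psumD//; last by move=> k; apply: iter_bessel_ge0; exact: nnlsc_bessel_sec.
  rewrite leeD2l//; apply: le_trans (psum_bound d0 _ (ltW K0)) _; first by rewrite mulr_ge0// ltW.
  rewrite lee_fin /C mulrA [e * N]mulrC ler_wpM2l ?mulr_ge0 ?(ltW N0) ?(ltW e0)//.
  by rewrite ler_expR ler_wpM2l ?(ltW K0)// (le_trans _ tT)// gerBl ltW.
rewrite ge0_integralD//; last 2 first.
- by move=> tau _; exact: (nnlsc_ge0 tau (nT x)).
- exact: (nnlsc_measurable (nT x)).
rewrite leeD2l//; apply: le_trans (integral_le_cst _ (lebesgue_itv_le _ _ t0) (nnlsc_cst _) C0 _) _ => //.
by rewrite subr0 lee_fin ler_wpM2l.
Qed.

(** On ]0, t[ only the Green operator changes, at the cost given by [psum_le_add]; the new part [t,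
    t'[ is bounded by its length. *)
Lemma duham_time_le t t' x : 0 <= t -> t <= t' -> t' <= T ->
  (duham F t' x <= duham F t x +
    ((t' - t) * (N * K * (K * T + 1) * expR (K * T)) * wgt a x)%:E)%E.
Proof.
move=> t0 tt' t'T; have t'0 := le_trans t0 tt'; have tT := le_trans tt' t'T.
have nT s := nnlsc_duham_sec s x nF.
have NK0 : 0 <= N * K by rewrite mulr_ge0// ltW.
have W0 := @wgt_ge0 R n a x.
apply: (@le_trans _ _ (\int[mu]_(tau in `]0%R, t[%classic `|` `[t, t'[%classic)
    duham_term F t' tau x)%E).
  apply: ge0_subset_integral => //.
  - exact: measurableU.
  - exact: (nnlsc_measurable (nT t')).
  - by move=> tau _; exact: (nnlsc_ge0 tau (nT t')).
  - move=> tau /=; rewrite !in_itv/= => /andP[tau0 taut']; have [taut|taut] := ltP tau t.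
      by left; rewrite tau0.
    by right; rewrite taut'.
rewrite ge0_integral_setU//; last 3 first.
- exact: (nnlsc_measurable (nT t')).
- by move=> tau _; exact: (nnlsc_ge0 tau (nT t')).
- apply/disj_setPS => tau /= []; rewrite !in_itv/= => /andP[_ taut] /andP[ttau _].
  by move: taut; rewrite ltNge ttau.
pose C1 := (t' - t) * (N * K * K * expR (K * T) * wgt a x).
pose C2 := N * K * expR (K * T) * wgt a x.
have C10 : 0 <= C1.
  by rewrite mulr_ge0 ?subr_ge0// mulr_ge0// mulr_ge0 ?expR_ge0// mulr_ge0// ltW.
have C20 : 0 <= C2 by rewrite mulr_ge0// mulr_ge0 ?expR_ge0.
have -> : (t' - t) * (N * K * (K * T + 1) * expR (K * T)) * wgt a x =
  C1 * T + C2 * (t' - t) by rewrite /C1 /C2; ring.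
apply: (@le_trans _ _ ((duham F t x + (C1 * T)%:E) + (C2 * (t' - t))%:E)%E); last first.
  by rewrite -addeA -EFinD.
apply: leeD; last first.
  apply: (integral_le_cst _ (lebesgue_itv_le _ _ tt') (nT t') C20) => //.
  move=> tau /=; rewrite in_itv/= => /andP[ttau taut'].
  by apply: duham_term_bound => //; exact: le_trans ttau.
apply: (@le_trans _ _ (\int[mu]_(tau in `]0%R, t[%classic) (duham_term F t tau x + C1%:E))%E).
  apply: ge0_le_integral => //.
  - by move=> tau _; exact: (nnlsc_ge0 tau (nT t')).
  - exact: (nnlsc_measurable (nT t')).
  - by apply: (nnlsc_measurable (nnlscD (nT t) (nnlsc_cst _))); rewrite lee_fin.
  move=> tau /=; rewrite in_itv/= => /andP[tau0 taut].
  have d0 : 0 <= t - tau by rewrite subr_ge0 ltW.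
  have dd : t - tau <= t' - tau by rewrite lerD2r.
  have d'0 := le_trans d0 dd; have tauT := le_trans (ltW taut) tT.
  have nB1 := nnlsc_bessel_sec tau nF.
  have nB2 : nnlsc (B (B (fun y => F (tau, y)))) by exact: (nnlsc_iter_bessel 1 nB1).
  rewrite /duham_term /gplus !ppart_id//.
  apply: le_trans (psum_le_add d0 dd _) _; first by move=> k; exact: iter_bessel_ge0.
  rewrite leeD2l// (_ : t' - tau - (t - tau) = t' - t); last by ring.
  rewrite /C1 EFinM lee_wpmul2l ?lee_fin ?subr_ge0//.
  rewrite (_ : (fun k => _) = fun k => iter k B (B (B (fun y => F (tau, y)))) x); last first.
    by apply/funext => k; rewrite iterSr.
  apply: psum_iter_bound => //.
  - by rewrite mulr_ge0// ltW.
  - move=> y; apply: (bessel_bound wK _ NK0) => // z; exact: bessel_source_bound.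
  - by rewrite (le_trans _ t'T)// gerBl ltW.
rewrite ge0_integralD//; last 2 first.
- by move=> tau _; exact: (nnlsc_ge0 tau (nT t)).
- exact: (nnlsc_measurable (nT t)).
rewrite leeD2l//; apply: le_trans (integral_le_cst _ (lebesgue_itv_le _ _ t0) (nnlsc_cst _) C10 _) _ => //.
by rewrite subr0 lee_fin ler_wpM2l.
Qed.

Lemma duham_time_ge t t' x : 0 <= t -> t <= t' ->
  (duham F t x <= (expR (t' - t))%:E * duham F t' x)%E.
Proof.
move=> t0 tt'; have nT s := nnlsc_duham_sec s x nF.
rewrite /duham -ge0_integralZl//; last 2 first.
- exact: (nnlsc_measurable (nT t')).
- by move=> tau _; exact: (nnlsc_ge0 tau (nT t')).
have nE := nnlscZ (expR_ge0 (t' - t)) (nT t').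
apply: (@le_trans _ _ (\int[mu]_(tau in `]0%R, t[%classic)
    ((expR (t' - t))%:E * duham_term F t' tau x))%E).
  apply: ge0_le_integral => //.
  - by move=> tau _; exact: (nnlsc_ge0 tau (nT t)).
  - exact: (nnlsc_measurable (nT t)).
  - exact: (nnlsc_measurable nE).
  move=> tau /=; rewrite in_itv/= => /andP[tau0 taut].
  have d0 : 0 <= t - tau by rewrite subr_ge0 ltW.
  have dd : t - tau <= t' - tau by rewrite lerD2r.
  rewrite /duham_term /gplus !ppart_id//; last exact: le_trans dd.
  rewrite (_ : t' - t = (t' - tau) - (t - tau)); last by ring.
  by apply: psum_le_expR => // k; apply: iter_bessel_ge0; exact: nnlsc_bessel_sec.
apply: ge0_subset_integral => //.
- exact: (nnlsc_measurable nE).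
- by move=> tau _; exact: (nnlsc_ge0 tau nE).
- move=> tau /=; rewrite !in_itv/= => /andP[-> taut]; exact: lt_le_trans tt'.
Qed.

End source.
End bounds.
End duhamel.

(** * The linear evolution of the initial datum *)

Section gplus_regularity.
Context {R : realType} (n : nat) (a K A : R) (u0 : 'rV[R]_n -> R).
Local Notation B := (@bessel_op R n).
Local Notation u0E := (fun y => (u0 y)%:E).
Local Opaque bessel_op.
Hypothesis (a0 : 0 <= a) (K0 : 0 < K) (A0 : 0 < A).
Hypothesis wK : forall x, (B (fun y => (wgt a y)%:E) x <= (K * wgt a x)%:E)%E.
Hypotheses (cu0 : continuous u0) (u00 : forall x, 0 <= u0 x).
Hypothesis u0A : forall x, u0 x <= A * wgt a x.

Let nu0 : nnlsc u0E := nnlsc_EFin cu0 u00.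
Let u0EA y : (u0E y <= (A * wgt a y)%:E)%E.
Proof. by rewrite lee_fin. Qed.

Lemma gplus_bound t T x : 0 <= T -> t <= T ->
  (gplus t u0E x <= (A * expR (K * T) * wgt a x)%:E)%E.
Proof.
move=> T0 tT; apply: (psum_iter_bound K0 wK x (ltW A0) nu0 u0EA (ppart_ge0 t)).
exact: ppart_le.
Qed.

(** The term k = 0 is u0 itself, not smoothed by B, and uses the continuity of u0. For k >= 1 the
    outer B gives the error e A K^(k-1), hence the constant 1 + A / K. *)
Lemma gplus_usc x T (e : R) : 0 < e -> \forall x' \near x, forall t, 0 <= t -> t <= T ->
  (gplus t u0E x' <= gplus t u0E x + (e * (1 + A / K) * expR (K * T))%:E)%E.
Proof.
move=> e0; have := bessel_usc a0 wK x e0.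
have : \forall x' \near x, u0 x' < u0 x + e.
  have ux : u0 x < u0 x + e by rewrite ltrDl.
  exact (cu0 (lt_nbhsl ux)).
apply: filterS2 => x' ux' usc t t0 tT; rewrite /gplus ppart_id//.
have D0 : 0 <= e * (1 + A / K) by rewrite mulr_ge0 ?(ltW e0)// addr_ge0// divr_ge0// ltW.
apply: (@le_trans _ _ (psum t (fun k => iter k B u0E x + (e * (1 + A / K) * K ^+ k)%:E)%E)).
  apply: le_psum => // k; first exact: iter_bessel_ge0.
  case: k => [|k].
    rewrite /= -EFinD lee_fin expr0 mulr1; apply: (le_trans (ltW ux')); rewrite lerD2l.
    by rewrite ler_peMr ?(ltW e0)// lerDl divr_ge0// ltW.
  rewrite !iterS.
  have nk : nnlsc (iter k B u0E) by exact: nnlsc_iter_bessel.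
  have AK : 0 < A * K ^+ k by rewrite mulr_gt0// exprn_gt0.
  have bk y : (iter k B u0E y <= (A * K ^+ k * wgt a y)%:E)%E.
    exact: (iter_bessel_bound K0 wK k y (ltW A0) nu0 u0EA).
  apply: (le_trans (usc _ _ AK nk bk)); rewrite leeD2l// lee_fin mulrC -mulrA.
  rewrite ler_wpM2l ?(ltW e0)// exprS mulrA mulrDl divfK ?gt_eqF//.
  by rewrite ler_wpM2r ?exprn_ge0 ?(ltW K0)// lerDr mul1r ltW.
rewrite psumD//; last 2 first.
- by move=> k; exact: iter_bessel_ge0.
- by move=> k; rewrite lee_fin mulr_ge0// exprn_ge0// ltW.
rewrite leeD2l//; apply: (le_trans (psum_bound t0 D0 (ltW K0))).
by rewrite lee_fin ler_wpM2l// ler_expR ler_wpM2l// ltW.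
Qed.

Lemma gplus_time_le t t' T x : 0 <= t -> t <= t' -> t' <= T ->
  (gplus t' u0E x <= gplus t u0E x + ((t' - t) * (A * K * expR (K * T)) * wgt a x)%:E)%E.
Proof.
move=> t0 tt' t'T; have t'0 := le_trans t0 tt'; rewrite /gplus !ppart_id//.
apply: (le_trans (psum_le_add t0 tt' (fun k => iter_bessel_ge0 k x nu0))).
rewrite leeD2l// -mulrA EFinM lee_wpmul2l ?lee_fin ?subr_ge0//.
rewrite (_ : (fun k => _) = fun k => iter k B (B u0E) x); last first.
  by apply/funext => k; rewrite iterSr.
apply: (psum_iter_bound K0 wK) => //; first by rewrite mulr_ge0// ltW.
  exact: (nnlsc_iter_bessel 1 nu0).
by move=> y; exact: (bessel_bound wK y (ltW A0) nu0 u0EA).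
Qed.

Lemma gplus_time_ge t t' x : 0 <= t -> t <= t' ->
  (gplus t u0E x <= (expR (t' - t))%:E * gplus t' u0E x)%E.
Proof.
move=> t0 tt'; rewrite /gplus !ppart_id//; last exact: le_trans tt'.
by apply: psum_le_expR => // k; exact: iter_bessel_ge0.
Qed.

End gplus_regularity.

(** * Sublinear growth, the space BC_a, real powers and gluing of semicontinuities *)

Section growth_bounds.
Context {R : realType}.

(** It suffices that M >= 2 A and M^(1 - p) >= 2 B, each summand then being at most M / 2. X solves
    the second condition with equality, and the added 1 makes M positive. *)
Lemma exists_sublinear_fixbound (A B p : R) : 0 <= A -> 0 <= B -> 0 < p -> p < 1 ->
  exists2 M, 0 < M & A + B * powR M p <= M.
Proof.
move=> A0 B0 p0 p1; have q0 : 0 < 1 - p by rewrite subr_gt0.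
pose X := powR (2 * B) (1 - p)^-1; have X0 : 0 <= X by exact: powR_ge0.
pose M := 2 * A + 1 + X; have M0 : 0 < M by rewrite /M; lra.
exists M => //.
have BM : 2 * B <= powR M (1 - p).
  have -> : 2 * B = powR X (1 - p).
    by rewrite /X -powRrM mulVf ?gt_eqF// powRr1// mulr_ge0.
  by apply: ge0_ler_powR; rewrite ?nnegrE ?(ltW q0) ?(ltW M0)// /M; lra.
have ME : M = powR M p * powR M (1 - p).
  by rewrite -powRD ?subrKC ?powRr1 ?(ltW M0)// gt_eqF// implybT.
have : powR M p * (2 * B) <= M by rewrite [leRHS]ME ler_wpM2l ?powR_ge0.
have : 2 * A <= M by rewrite /M; lra.
by move: (powR M p) => Mp; lra.
Qed.

Lemma wgt_ge1 n a (x : 'rV[R]_n) : 0 <= a -> 1 <= wgt a x.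
Proof.
move=> a0; rewrite -[leLHS](powRr0 (1 + sqn x)) ler_powR ?divr_ge0//.
by rewrite lerDl sqn_ge0.
Qed.

Lemma weight_wgt n a (x : 'rV[R]_n) : weight a x * wgt a x = 1.
Proof.
rewrite /weight /wgt enorm_sqr powRN mulVf// gt_eqF// powR_gt0//.
by rewrite ltr_pwDl ?sqn_ge0.
Qed.

Lemma enorm_powR n a (x : 'rV[R]_n) : powR (enorm x) a = powR (sqn x) (a / 2).
Proof.
by rewrite /enorm -/(sqn x) -powR12_sqrt ?sqn_ge0// -powRrM mulrC.
Qed.

Lemma coord_le_enorm n (x : 'rV[R]_n) i : `|x ord0 i| <= enorm x.
Proof.
rewrite /enorm -sqrtr_sqr ler_wsqrtr// (bigD1 i)//= lerDl sumr_ge0// => j _.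
exact: sqr_ge0.
Qed.

(** The growth bound only speaks of large |x|. On the cube of half-side |M| the extreme value
    theorem and w >= 1 take over. *)
Lemma BC_wgt_bound n a (u0 : 'rV[R]_n -> R) : 0 <= a -> BC a u0 ->
  exists2 A, 0 < A & forall x, u0 x <= A * wgt a x.
Proof.
move=> a0 [cu0 [C [M CM]]]; pose r := `|M|.
pose Q := [set x : 'rV[R]_n | forall i, x ord0 i \in `[- r, r]].
have cQ : compact Q by exact: (@rV_compact _ n (fun=> `[- r, r]%classic) (fun=> @segment_compact _ _ _)).
have Q0 : Q !=set0.
  by exists 0 => i; rewrite mxE in_itv/= oppr_le0 normr_ge0.
have [c _ cmax] := EVT_max_rV Q0 cQ (continuous_subspaceT cu0).
exists (`|C| + `|u0 c| + 1); first by rewrite ltr_wpDl// addr_ge0.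
move=> x; have w1 := wgt_ge1 x a0.
have [Qx|nQx] := pselect (Q x).
  apply: (@le_trans _ _ `|u0 c|).
    by apply: le_trans (ler_norm _); apply: cmax; rewrite inE.
  rewrite -[leLHS]mulr1; apply: ler_pM => //.
  by have := normr_ge0 C; move: `|C| `|u0 c| => ? ?; lra.
have Mx : M <= enorm x.
  move/existsNP : nQx => [i]; rewrite in_itv/= -ler_norml => /negP; rewrite -ltNge => rx.
  by apply: le_trans (coord_le_enorm x i); apply: le_trans (ler_norm M) (ltW rx).
apply: (le_trans (ler_norm _)); apply: (le_trans (CM x Mx)).
apply: (@le_trans _ _ (`|C| * wgt a x)).
  apply: (@le_trans _ _ (`|C| * powR (enorm x) a)).
    by rewrite ler_wpM2r ?powR_ge0// ler_norm.
  rewrite ler_wpM2l// enorm_powR.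
  by apply: ge0_ler_powR; rewrite ?nnegrE ?divr_ge0 ?sqn_ge0 ?addr_ge0 ?sqn_ge0// lerDr.
rewrite ler_wpM2r ?wgt_ge0//.
by have := normr_ge0 (u0 c); move: `|C| `|u0 c| => ? ?; lra.
Qed.

Lemma lt_powR_inv (p c v : R) : 0 < p -> 0 <= c -> 0 <= v ->
  (c < powR v p) = (powR c p^-1 < v).
Proof.
move=> p0 c0 v0; have cE : c = powR (powR c p^-1) p by rewrite -powRrM mulVf ?gt_eqF// powRr1.
have d0 : 0 <= powR c p^-1 by exact: powR_ge0.
rewrite {1}cE; apply/idP/idP; last by move=> cv; apply: gt0_ltr_powR.
by apply: contraTT; rewrite -!leNgt => vc; apply: ge0_ler_powR; rewrite ?nnegrE ?(ltW p0).
Qed.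

Lemma nnlsc_powR (X : topologicalType) (U : X -> \bar R) p : 0 < p -> nnlsc U ->
  (forall z, U z \is a fin_num) -> nnlsc (fun z => (powR (fine (U z)) p)%:E).
Proof.
move=> p0 nU fU; apply: nnlscW => [z|z c c0]; first by rewrite lee_fin powR_ge0.
have U0 z' : 0 <= fine (U z') by rewrite fine_ge0// nnlsc_ge0.
rewrite lte_fin lt_powR_inv// => cz.
have := nnlsc_near (x := z) (a := powR c p^-1) nU; rewrite -(fineK (fU z)) lte_fin => /(_ cz).
by apply: filterS => z'; rewrite -(fineK (fU z')) !lte_fin/= lt_powR_inv.
Qed.

Lemma ndcvg_powR (u : nat -> \bar R) l p : 0 < p -> (forall k, 0 <= u k)%E ->
  l \is a fin_num -> ndcvg u l -> ndcvg (fun k => (powR (fine (u k)) p)%:E) (powR (fine l) p)%:E.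
Proof.
move=> p0 u0 fl ul; have ulE k := ndcvg_le k ul.
have fu k : u k \is a fin_num.
  by apply: (fin_num_le (r := fine l) (u0 k)); rewrite fineK.
have fu0 k : 0 <= fine (u k) by rewrite fine_ge0.
have l0 : 0 <= fine l by rewrite fine_ge0// (le_trans (u0 0%N)).
have le_pow r s : 0 <= r -> 0 <= s -> r <= s -> ((powR r p)%:E <= (powR s p)%:E)%E.
  by move=> r0 s0 rs; rewrite lee_fin; apply: ge0_ler_powR; rewrite ?nnegrE ?(ltW p0).
apply/ndcvgP; split.
  by move=> i j ij; apply: le_pow => //; rewrite fine_le//; exact: ul.1.
apply/eqP; rewrite eq_le; apply/andP; split; last first.
  by apply: ge_ereal_sup => _ [k _ <-]; apply: le_pow => //; rewrite fine_le.
apply: lee_EFin_lt => b; have [b0|b0] := leP 0 b; last first.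
  move=> _; apply: (@le_trans _ _ (powR (fine (u 0%N)) p)%:E).
    by rewrite lee_fin (le_trans (ltW b0))// powR_ge0.
  by apply: ereal_sup_ubound; exists 0%N.
rewrite lte_fin lt_powR_inv// -lte_fin fineK// => /(ndcvg_lt ul)[k bk].
apply: (@le_trans _ _ (powR (fine (u k)) p)%:E); last by apply: ereal_sup_ubound; exists k.
by rewrite lee_fin ltW// lt_powR_inv// -lte_fin fineK.
Qed.

Lemma lsc_usc_continuous (X : topologicalType) (f : X -> R) :
  (forall x e, 0 < e -> \forall x' \near x, f x - e < f x') ->
  (forall x e, 0 < e -> \forall x' \near x, f x' <= f x + e) -> continuous f.
Proof.
move=> lf uf x; apply/cvg_ballP => e e0; have e20 : 0 < e / 2 by rewrite divr_gt0.
have := lf x _ e20; have := uf x _ e20; apply: filterS2 => x' h1 h2.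
by rewrite /ball/= ltr_norml; apply/andP; split; lra.
Qed.

(** V is continuous only within t >= 0; composing with the clamped time yields a function continuous
    for all real t. *)
Lemma within_continuous_comp (X Y Z : topologicalType) (D : set Y) (f : Y -> Z) (phi : X -> Y) :
  {within D, continuous f} -> continuous phi -> (forall x, D (phi x)) ->
  continuous (fun x => f (phi x)).
Proof.
move=> /subspace_continuousP cf cphi Dphi x W nW.
have := cf (phi x) (Dphi x) W nW; rewrite /= nbhs_simpl/= => wW.
have := cphi x _ wW; rewrite /= nbhs_simpl/=.
by apply: filterS => y; apply; exact: Dphi.
Qed.

End growth_bounds.

(** * Monotone iteration *)

Section sublinear_iteration.
Context {R : realType} (n : nat) (p a K A : R).
Variables (V : 'rV[R]_n -> R -> R) (u0 : 'rV[R]_n -> R) (M N : R -> R).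
Local Notation B := (@bessel_op R n).
Local Notation mu := (@lebesgue_measure R).
Local Notation u0E := (fun y => (u0 y)%:E).
Local Opaque bessel_op.
Hypotheses (a0 : 0 <= a) (K0 : 0 < K) (A0 : 0 < A) (p0 : 0 < p).
Hypothesis wK : forall x, (B (fun y => (wgt a y)%:E) x <= (K * wgt a x)%:E)%E.
Hypotheses (cu0 : continuous u0) (u00 : forall x, 0 <= u0 x).
Hypothesis u0A : forall x, u0 x <= A * wgt a x.
Hypothesis cV : continuous (fun z : R * 'rV[R]_n => V z.2 (ppart z.1)).
Hypothesis V0 : forall x t, 0 <= t -> 0 <= V x t.
Hypotheses (M0 : forall T, 0 <= T -> 0 < M T) (N0 : forall T, 0 <= T -> 0 < N T).
(** The iteration sees p < 1 and the exponent condition only through [VN], which says that the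
    source of a function below M w is below N w, and [MN], which closes the bound. *)
Hypothesis VN : forall T t, 0 <= T -> 0 <= t -> t <= T -> forall x r,
  0 <= r -> r <= M T * wgt a x -> V x t * powR r p <= N T * wgt a x.
Hypothesis MN : forall T, 0 <= T ->
  A * expR (K * T) + T * (N T * K) * expR (K * T) <= M T.

Implicit Types U : R * 'rV[R]_n -> \bar R.

Definition source U (z : R * 'rV[R]_n) : \bar R :=
  (V z.2 (ppart z.1) * powR (fine (U z)) p)%:E.

Definition picard U (z : R * 'rV[R]_n) : \bar R :=
  (gplus z.1 u0E z.2 + duham (source U) z.1 z.2)%E.

(** One function is bounded for every T at once, each horizon with its own constant; t <= T includes
    negative times, where the bound with the constant of horizon 0 applies too. *)
Definition admissible U := nnlsc U /\ forall T, 0 <= T -> forall t, t <= T -> forall x,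
  (U (t, x) <= (M T * wgt a x)%:E)%E.

Let nu0 : nnlsc u0E := nnlsc_EFin cu0 u00.

Lemma admissible_fin U z : admissible U -> U z \is a fin_num.
Proof.
case: z => t x [nU bU]; apply: (fin_num_le (nnlsc_ge0 _ nU)).
by apply: (bU (ppart t) (ppart_ge0 t)); rewrite /ppart le_max lexx.
Qed.

Lemma fine_admissible U z : admissible U -> (fine (U z))%:E = U z.
Proof. by move=> aU; rewrite fineK// admissible_fin. Qed.

Lemma fine_admissible_ge0 U z : admissible U -> 0 <= fine (U z).
Proof. by case=> nU _; rewrite fine_ge0// nnlsc_ge0. Qed.

Lemma fine_admissible_le U T t x : admissible U -> 0 <= T -> t <= T ->
  fine (U (t, x)) <= M T * wgt a x.
Proof. by move=> aU T0 tT; rewrite -lee_fin fine_admissible//; exact: aU.2. Qed.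

Lemma nnlsc_source U : admissible U -> nnlsc (source U).
Proof.
move=> aU.
rewrite (_ : source U = fun z => (V z.2 (ppart z.1))%:E * (powR (fine (U z)) p)%:E)%E//.
apply: nnlscM; first by apply: nnlsc_EFin => // z; exact/V0/ppart_ge0.
by apply: nnlsc_powR => //; [exact: aU.1|move=> z; exact: admissible_fin].
Qed.

Lemma source_bound U T : admissible U -> 0 <= T -> forall tau, tau <= T -> forall y,
  (source U (tau, y) <= (N T * wgt a y)%:E)%E.
Proof.
move=> aU T0 tau tT y; rewrite lee_fin /=.
apply: VN => //; [exact: ppart_ge0|exact: ppart_le|exact: fine_admissible_ge0|].
exact: fine_admissible_le.
Qed.

Lemma nnlsc_picard U : admissible U -> nnlsc (picard U).
Proof.
by move=> aU; apply: nnlscD; [exact: nnlsc_gplus|apply: nnlsc_duham; exact: nnlsc_source].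
Qed.

Lemma admissible_picard U : admissible U -> admissible (picard U).
Proof.
move=> aU; split; first exact: nnlsc_picard.
move=> T T0 t tT x; rewrite /picard/=.
apply: (@le_trans _ _ ((A * expR (K * T) * wgt a x)%:E +
    (T * (N T * K) * expR (K * T) * wgt a x)%:E)%E).
  apply: leeD; first exact: (gplus_bound K0 A0 wK cu0 u00 u0A).
  exact: (duham_bound K0 wK T0 (N0 T0) (nnlsc_source aU) (source_bound aU T0)).
by rewrite -EFinD lee_fin -mulrDl ler_wpM2r ?wgt_ge0// MN.
Qed.

Lemma le_source U U' z : admissible U -> admissible U' ->
  (U z <= U' z)%E -> (source U z <= source U' z)%E.
Proof.
move=> aU aU' UU'; rewrite lee_fin ler_wpM2l ?V0 ?ppart_ge0//.
apply: ge0_ler_powR; rewrite ?nnegrE ?fine_admissible_ge0 ?(ltW p0)//.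
by rewrite -lee_fin !fine_admissible.
Qed.

Lemma le_picard U U' z : admissible U -> admissible U' ->
  (forall z, U z <= U' z)%E -> (picard U z <= picard U' z)%E.
Proof.
move=> aU aU' UU'; apply: leeD; first exact: lexx.
by apply: le_duham => [||z']; [exact: nnlsc_source|exact: nnlsc_source|exact: le_source].
Qed.

Definition picard_seq k := iter k picard (fun=> 0%E).

Lemma admissible0 : admissible (fun=> 0%E).
Proof.
split; first exact: nnlsc_cst.
by move=> T T0 t _ x; rewrite lee_fin mulr_ge0 ?wgt_ge0// ltW// M0.
Qed.

Lemma admissible_seq k : admissible (picard_seq k).
Proof. by elim: k => [|k IH]; [exact: admissible0|exact: admissible_picard]. Qed.

Lemma picard_seq_nd z : nondecreasing_seq (picard_seq ^~ z).
Proof.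
apply/nondecreasing_seqP => k; elim: k z => [|k IH] z.
  exact: (nnlsc_ge0 z (admissible_seq 1).1).
exact: (le_picard z (admissible_seq k) (admissible_seq k.+1) IH).
Qed.

Definition mild_sol z : \bar R := ereal_sup (range (picard_seq ^~ z)).

Lemma mild_sol_ndcvg z : ndcvg (picard_seq ^~ z) (mild_sol z).
Proof. by apply/ndcvgP; split => //; exact: picard_seq_nd. Qed.

Lemma admissible_mild_sol : admissible mild_sol.
Proof.
split.
  exact: (nnlsc_ndcvg (fun k => (admissible_seq k).1) mild_sol_ndcvg).
move=> T T0 t tT x; apply: ge_ereal_sup => _ [k _ <-].
exact: (admissible_seq k).2.
Qed.

Lemma ndcvg_source z : ndcvg (fun k => source (picard_seq k) z) (source mild_sol z).
Proof.
have aS := admissible_seq; have aM := admissible_mild_sol.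
rewrite (_ : (fun k => _) = fun k => ((V z.2 (ppart z.1))%:E *
  (powR (fine (picard_seq k z)) p)%:E)%E)// /source EFinM; apply: ndcvg_mule.
- by rewrite lee_fin V0// ppart_ge0.
- by move=> k; rewrite lee_fin powR_ge0.
- apply: ndcvg_powR => //; [|exact: admissible_fin|exact: mild_sol_ndcvg].
  by move=> k; exact: (nnlsc_ge0 z (aS k).1).
Qed.

(** Each ingredient of [picard] commutes with increasing limits, so the shifted sequence converges
    both to [picard mild_sol] and to [mild_sol]. *)
Lemma picard_mild_sol z : picard mild_sol z = mild_sol z.
Proof.
have cv : ndcvg (fun k => picard_seq k.+1 z) (picard mild_sol z).
  apply: ndcvgD => [k|k||].
  - exact: (nnlsc_ge0 z (nnlsc_gplus nu0)).
  - exact: (nnlsc_ge0 z (nnlsc_duham (nnlsc_source (admissible_seq k)))).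
  - by split; [move=> ? ? _|exact: cvg_cst].
  - apply: ndcvg_duham; [by move=> k; apply: nnlsc_source; exact: admissible_seq|].
    exact: ndcvg_source.
have [_ cv'] := mild_sol_ndcvg z.
have cv1 : picard_seq k.+1 z @[k --> \oo] --> mild_sol z.
  by rewrite (cvg_shiftS (picard_seq ^~ z)).
exact: (cvg_unique _ cv.2 cv1).
Qed.

Definition mild_u x t : R := fine (mild_sol (t, x)).

Lemma mild_uE x t : (mild_u x t)%:E =
  (gplus t u0E x + duham (source mild_sol) t x)%E.
Proof.
rewrite /mild_u fine_admissible; last exact: admissible_mild_sol.
by rewrite -picard_mild_sol.
Qed.

Lemma mild_u_eq : mild_eq p V u0 mild_u.
Proof.
move=> x t t0; apply: (etrans (mild_uE x t)).
have -> : gplus t u0E x = green_op t u0E x by rewrite /gplus ppart_id.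
suff -> : duham (source mild_sol) t x = (\int[mu]_(tau in `[0%R, t]%classic)
    green_op (t - tau) (B (fun y => (V y tau * powR (mild_u y tau) p)%:E)) x)%E by [].
have nS := nnlsc_source admissible_mild_sol.
(* The two endpoints form a null set, so the closed interval of the equation may replace the open
   one. *)
rewrite /duham -(@integral_itv_bndoo _ 0 t _ true false); last first.
  exact: (nnlsc_measurable (nnlsc_duham_sec t x nS)).
apply: eq_integral => tau; rewrite inE/= in_itv/= => /andP[tau0 taut].
have -> : (fun y => (V y tau * powR (mild_u y tau) p)%:E) = fun y => source mild_sol (tau, y).
  by apply/funext => y; rewrite /source/= ppart_id.
by rewrite /duham_term /gplus ppart_id ?subr_ge0.
Qed.

Lemma mild_u_lsc t x (e : R) : 0 < e -> \forall x' \near x, mild_u x t - e < mild_u x' t.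
Proof.
move=> e0; have nS := nnlsc_sec t admissible_mild_sol.1.
have ex : ((mild_u x t - e)%:E < mild_sol (t, x))%E.
  by rewrite -(fine_admissible _ admissible_mild_sol) lte_fin gtrBl.
apply: filterS (nnlsc_near nS ex) => x'.
by rewrite -(fine_admissible (t, x') admissible_mild_sol) lte_fin.
Qed.

Lemma mild_u_usc t x (e : R) : 0 <= t -> 0 < e ->
  \forall x' \near x, mild_u x' t <= mild_u x t + e.
Proof.
move=> t0 e0; pose C := (1 + A / K) * expR (K * t) + N t * expR (K * t) * t.
have C0 : 0 <= C.
  rewrite addr_ge0 ?mulr_ge0 ?expR_ge0// ?(ltW (N0 t0))//.
  by rewrite addr_ge0// divr_ge0// ltW.
pose d := e / (C + 1); have d0 : 0 < d by rewrite divr_gt0// ltr_wpDl.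
have aM := admissible_mild_sol.
have := gplus_usc a0 K0 A0 wK cu0 u00 u0A x t d0.
have := duham_usc a0 K0 wK (N0 t0) (nnlsc_source aM) (source_bound aM t0) x d0.
apply: filterS2 => x' du gu.
rewrite -lee_fin EFinD !mild_uE.
apply: (le_trans (leeD (gu t t0 (lexx _)) (du t t0 (lexx _)))).
rewrite addeACA leeD2l// -EFinD lee_fin.
have -> : d * (1 + A / K) * expR (K * t) + d * (N t * expR (K * t)) * t = d * C.
  by rewrite /C; ring.
by rewrite /d mulrAC ler_pdivrMr ?ltr_wpDl// ler_wpM2l ?(ltW e0)// lerDl.
Qed.

Lemma mild_u_continuous t : 0 <= t -> continuous (fun x => mild_u x t).
Proof.
move=> t0; apply: lsc_usc_continuous => x e e0; first exact: mild_u_lsc.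
exact: mild_u_usc.
Qed.

(** The increase of u is bounded by the two [time_le] estimates. For the decrease with d = t' - t,
    u(t) <= e^d u(t') and e^(-d) >= 1 - d give u(t) - u(t') <= d u(t) <= d M w. *)
Lemma mild_u_lipschitz T : 0 <= T -> exists2 L, 0 < L & forall t t' x,
  0 <= t -> t <= t' -> t' <= T ->
  `|mild_u x t' - mild_u x t| <= (t' - t) * L * wgt a x.
Proof.
move=> T0; pose C1 := A * K * expR (K * T).
pose C2 := N T * K * (K * T + 1) * expR (K * T).
have NT := N0 T0.
have C10 : 0 <= C1 by rewrite !mulr_ge0 ?expR_ge0// ltW.
have C20 : 0 <= C2 by rewrite !mulr_ge0 ?expR_ge0 ?addr_ge0 ?mulr_ge0// ltW.
exists (C1 + C2 + M T); first by rewrite ltr_wpDl ?addr_ge0// M0.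
move=> t t' x t0 tt' t'T; have aM := admissible_mild_sol.
have tT := le_trans tt' t'T.
have W0 := wgt_ge0 a x; have d0 : 0 <= t' - t by rewrite subr_ge0.
have nS := nnlsc_source aM.
have up : mild_u x t' <= mild_u x t + (t' - t) * (C1 + C2) * wgt a x.
  have gd := leeD (gplus_time_le K0 A0 wK cu0 u00 u0A x t0 tt' t'T)
    (duham_time_le K0 wK NT nS (source_bound aM T0) x t0 tt' t'T).
  rewrite addeACA -(mild_uE x t) -(mild_uE x t') -!EFinD lee_fin in gd.
  by apply: (le_trans gd); rewrite lerD2l -mulrDl -mulrDr.
have lo : mild_u x t <= expR (t' - t) * mild_u x t'.
  rewrite -lee_fin EFinM !mild_uE ge0_muleDr; last 2 first.
  - exact: (nnlsc_ge0 (t', x) (nnlsc_gplus nu0)).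
  - exact: (nnlsc_ge0 (t', x) (nnlsc_duham nS)).
  apply: leeD; first exact: (gplus_time_ge cu0 u00 x t0 tt').
  exact: (duham_time_ge nS x t0 tt').
have lo' : (1 - (t' - t)) * mild_u x t <= mild_u x t'.
  have ut0 : 0 <= mild_u x t by exact: fine_admissible_ge0.
  apply: (@le_trans _ _ (expR (- (t' - t)) * mild_u x t)).
    by rewrite ler_wpM2r// expR_ge1Dx.
  apply: (le_trans (ler_wpM2l (expR_ge0 _) lo)).
  by rewrite mulrA -expRD addNr expR0 mul1r.
have uM : mild_u x t <= M T * wgt a x by exact: fine_admissible_le.
have h1 : (t' - t) * mild_u x t <= (t' - t) * (M T * wgt a x) by rewrite ler_wpM2l.
have h2 : 0 <= (t' - t) * ((C1 + C2) * wgt a x) by rewrite !mulr_ge0// addr_ge0.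
have h3 : 0 <= (t' - t) * (M T * wgt a x) by rewrite !mulr_ge0// ltW// M0.
by rewrite ler_norml; apply/andP; split; lra.
Qed.

Lemma mild_u_Zspace : Zspace a mild_u.
Proof.
have aM := admissible_mild_sol; split.
  move=> t t0; split; first exact: mild_u_continuous.
  (* For |x| >= 1 one has 1 + |x|^2 <= 2 |x|^2, which produces the factor 2^(a/2). *)
  exists (M t * powR 2 (a / 2)), 1 => x x1.
  rewrite ger0_norm ?fine_admissible_ge0//.
  apply: (le_trans (fine_admissible_le x aM t0 (lexx t))).
  rewrite -mulrA ler_wpM2l ?(ltW (M0 t0))// enorm_powR -powRM ?sqn_ge0//.
  apply: ge0_ler_powR; rewrite ?nnegrE ?divr_ge0 ?addr_ge0 ?mulr_ge0 ?sqn_ge0//.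
  suff : 1 <= sqn x by lra.
  by rewrite -enorm_sqr expr_ge1// (le_trans ler01).
move=> t0 t00 e e0; have T0 : 0 <= t0 + 1 by rewrite addr_ge0.
have [L L0 LP] := mild_u_lipschitz T0.
(* The 1 keeps t below t0 + 1, the horizon for which L was chosen. *)
exists (Num.min 1 (e / L)); first by rewrite lt_min ltr01 divr_gt0.
move=> t tge0; rewrite lt_min => /andP[d1 dL] x.
have tT : t <= t0 + 1 by move: d1; rewrite ltr_norml; lra.
have t0T : t0 <= t0 + 1 by rewrite lerDl.
have H : `|mild_u x t - mild_u x t0| <= `|t - t0| * L * wgt a x.
  have [tt0|t0t] := leP t t0.
    by rewrite distrC [`|t - t0|]distrC [X in X * L]ger0_norm ?subr_ge0//; exact: LP.
  by rewrite [X in X * L]gtr0_norm ?subr_gt0//; apply: LP => //; exact: ltW.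
apply: (@le_trans _ _ (weight a x * (`|t - t0| * L * wgt a x))).
  by rewrite ler_wpM2l ?powR_ge0.
by rewrite mulrCA weight_wgt mulr1 -ler_pdivlMr// ltW.
Qed.

Lemma mild_u_solution : global_mild_solution a p V u0 mild_u.
Proof.
split; last by split; [exact: mild_u_Zspace|exact: mild_u_eq].
by move=> x t _; apply: fine_admissible_ge0; exact: admissible_mild_sol.
Qed.

End sublinear_iteration.

Theorem mainTheorem1 (R : realType) (n : nat) (hn : (1 <= n)%N) (p : R)
  (hp0 : 0 < p) (hp1 : p < 1)
  (V : 'rV[R]_n -> R -> R)
  (hVc : {within [set xt : 'rV[R]_n * R | 0 <= xt.2],
           continuous (fun xt : 'rV[R]_n * R => V xt.1 xt.2)})
  (hV0 : forall x t, 0 <= t -> 0 <= V x t)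
  (Lam : R -> R) (hLc : {within `[0%R, +oo[%classic, continuous Lam})
  (hL0 : forall t, 0 <= t -> 0 <= Lam t)
  (theta sigma : R) (htheta : 0 < theta)
  (hVbound : forall x t, 0 <= t ->
     V x t <= theta * Lam t * powR (1 + enorm x ^+ 2) (ppart sigma / 2))
  (a : R) (ha : ppart sigma / (1 - p) <= a)
  (u0 : 'rV[R]_n -> R) (hu0 : BC a u0) (hu0pos : forall x, 0 <= u0 x) :
  exists u : 'rV[R]_n -> R -> R, global_mild_solution a p V u0 u.
Proof.
have q0 : 0 < 1 - p by rewrite subr_gt0.
have a0 : 0 <= a by apply: le_trans ha; rewrite divr_ge0 ?ppart_ge0// ltW.
have [K K0 wK] := @bessel_wgt_bound R n a a0.
have [A A0 u0A] := BC_wgt_bound a0 hu0.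
have cV : continuous (fun z : R * 'rV[R]_n => V z.2 (ppart z.1)).
  apply: (within_continuous_comp (phi := fun z : R * 'rV[R]_n => (z.2, ppart z.1)) hVc).
    apply: continuous_pair; first exact: continuous_snd.
    exact: (continuous_compT (@continuous_fst _ _) (@continuous_ppart R)).
  by move=> z; exact: ppart_ge0.
have /choice[L LP] : forall T : R, exists l : R, 0 <= T ->
    0 <= l /\ forall t, 0 <= t -> t <= T -> Lam t <= l.
  move=> T; have [T0|T0] := leP 0 T; last by exists 0 => T0'; lra.
  have cL : {within `[0, T], continuous Lam}.
    by apply: continuous_subspaceW hLc => t /=; rewrite !in_itv/= => /andP[->].
  have [c cT cmax] := EVT_max T0 cL.
  exists (Lam c) => _; split; first by apply: hL0; move: cT; rewrite in_itv => /andP[].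
  by move=> t t0 tT; apply: cmax; rewrite in_itv/= t0.
(* The term 1 added to theta L m^p keeps N strictly positive even where L vanishes. Its contribution
   is independent of m, so the inequality for m remains sublinear. For T < 0 the value 0 is a
   dummy. *)
have /choice[M MP] : forall T : R, exists m : R, 0 <= T -> 0 < m /\
    A * expR (K * T) + T * ((theta * L T * powR m p + 1) * K) * expR (K * T) <= m.
  move=> T; have [T0|T0] := leP 0 T; last by exists 0 => T0'; lra.
  have [L0 _] := LP T T0.
  have TK : 0 <= T * K * expR (K * T) by rewrite !mulr_ge0 ?expR_ge0// ltW.
  have [||m m0 mP] := @exists_sublinear_fixbound R
    (A * expR (K * T) + T * K * expR (K * T)) (T * K * expR (K * T) * (theta * L T)) p _ _ hp0 hp1.
  - by rewrite addr_ge0// mulr_ge0 ?expR_ge0// ltW.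
  - by rewrite mulr_ge0// mulr_ge0// ltW.
  by exists m => _; split=> //; move: mP; lra.
exists (mild_u p V u0); apply: (@mild_u_solution R n p a K A V u0 M
  (fun T => theta * L T * powR (M T) p + 1)) => //.
- exact: hu0.1.
- by move=> T T0; case: (MP T T0).
- move=> T T0; rewrite ltr_wpDl// mulr_ge0 ?powR_ge0// mulr_ge0 ?(ltW htheta)//.
  by case: (LP T T0).
- move=> T t T0 t0 tT x r r0 rM; have [l0 lP] := LP T T0; have [m0 _] := MP T T0.
  have b1 : 1 <= 1 + sqn x by rewrite lerDl sqn_ge0.
  have b00 : 1 + sqn x != 0 by rewrite gt_eqF// (lt_le_trans ltr01).
  have Lt0 : 0 <= theta * L T by rewrite mulr_ge0// ltW.
  apply: (@le_trans _ _ (theta * L T * powR (1 + sqn x) (ppart sigma / 2) *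
      (powR (M T) p * powR (wgt a x) p))).
    apply: ler_pM; rewrite ?hV0 ?powR_ge0//.
      apply: (le_trans (hVbound x t t0)); rewrite enorm_sqr ler_wpM2r ?powR_ge0//.
      by rewrite ler_wpM2l ?(ltW htheta)// lP.
    rewrite -powRM ?wgt_ge0 ?(ltW m0)//.
    apply: ge0_ler_powR; rewrite ?nnegrE ?(ltW hp0)//.
    by rewrite mulr_ge0 ?wgt_ge0// ltW.
  rewrite [leLHS](_ : _ = theta * L T * powR (M T) p *
    (powR (1 + sqn x) (ppart sigma / 2) * powR (wgt a x) p)); last by ring.
  apply: (@le_trans _ _ (theta * L T * powR (M T) p * wgt a x)); last first.
    by rewrite ler_wpM2r ?wgt_ge0// lerDl.
  apply: ler_wpM2l; first by rewrite mulr_ge0 ?powR_ge0.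
  (* The exponents add up to (sigma_+ + a p) / 2, at most a / 2 precisely because sigma_+ <= a (1 -
     p). *)
  rewrite /wgt -powRrM -powRD; last by rewrite b00 implybT.
  apply: ler_powR => //.
  by move: ha; rewrite ler_pdivrMr//; lra.
- by move=> T T0; case: (MP T T0).
Qed.
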